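(* Let $X(z_1,z_2)=\frac{z_2\Omega}{z_1-z_2}+p(z_1,z_2)$ be a quasi-trigonometric solution of the classical Yang-Baxter equation. 1. There is a transformation $\Psi(z)$, with values in $\mathrm{Aut}(\mathfrak g)$ and holomorphic around $z=1$, such that $$\left(\Psi(z_1)^{-1}\otimes\Psi(z_2)^{-1}\right)X(z_1,z_2)=Y\!\left(\frac{z_1}{z_2}\right),$$ where $Y(z)=\frac{\Omega}{z-1}+s(z)$ with $s(z)$ holomorphic around $z=1$. 2. $Y(e^{\lambda})$ is a trigonometric solution, in the sense of Belavin and Drinfeld, of the classical Yang-Baxter equation with one spectral parameter.
   Context: $\mathfrak g$ is a simple complex finite-dimensional Lie algebra, $K$ its Killing form, and $\Omega=\sum_i I_i\otimes I_i\in\mathfrak g\otimes\mathfrak g$ the quadratic Casimir element ($\{I_i\}$ an orthonormal basis for $K$). A quasi-trigonometric solution is a function $X(u,v)=\frac{v\Omega}{u-v}+p(u,v)$, with $p(u,v)$ a polynomial in $u,v$ with coefficients in $\mathfrak g\otimes\mathfrak g$, satisfying the classical Yang-Baxter equation (CYBE), i.e. the two equations $$[X^{12}(u_1,u_2),X^{13}(u_1,u_3)]+[X^{12}(u_1,u_2),X^{23}(u_2,u_3)]+[X^{13}(u_1,u_3),X^{23}(u_2,u_3)]=0,$$ $$X^{12}(u,v)=-X^{21}(v,u).$$ The CYBE with one spectral parameter, for a meromorphic $\mathfrak g\otimes\mathfrak g$-valued function $Z(\lambda)$ defined near $0$, is $$[Z^{12}(\lambda),Z^{13}(\lambda+\mu)]+[Z^{12}(\lambda),Z^{23}(\mu)]+[Z^{13}(\lambda+\mu),Z^{23}(\mu)]=0.$$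 A solution $Z$ is nondegenerate if $Z(\lambda)$, as an element of $\mathfrak g\otimes\mathfrak g$, has maximal rank for generic $\lambda$. By Belavin–Drinfeld, a nondegenerate solution extends meromorphically to $\mathbb C$ and its set of poles is a discrete subgroup of $\mathbb C$; the solution is called trigonometric if this subgroup has rank one. *)

(* Defs.v *)
From HB Require Import structures.
From mathcomp Require Import all_boot all_order all_algebra.
From mathcomp Require Import complex.
From mathcomp Require Import all_classical all_reals all_analysis.

Set Implicit Arguments.
Unset Strict Implicit.
Unset Printing Implicit Defensive.

Import Order.TTheory GRing.Theory Num.Theory numFieldNormedType.Exports.

#[global] Open Scope classical_set_scope.
#[global] Open Scope ring_scope.
#[global] Open Scope complex_scope.

(* The field of complex numbers is R[i] for R : realType; R[i]^o is the same
   field seen as a normed space over itself, so that [derivable f z 1] is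
   complex differentiability. *)

Definition cexp (R : realType) (z : R[i]) : R[i] :=
  (expR (complex.Re z))%:C * (cos (complex.Im z) +i* sin (complex.Im z)).

Definition holomorphic_at (R : realType) (W : normedModType R[i])
    (F : R[i] -> W) (a : R[i]) : Prop :=
  \forall z \near (a : R[i]^o), derivable (F : R[i]^o -> W) z 1.

(* The value of F at a is irrelevant: functions are total in Rocq, so a
   meromorphic function carries an arbitrary value at each of its poles. *)
Definition meromorphic_at (R : realType) (W : normedModType R[i])
    (F : R[i] -> W) (a : R[i]) : Prop :=
  exists (k : nat) (G : R[i] -> W),
    holomorphic_at G a /\
    \forall z \near (a : R[i]^o)^', F z = (z - a) ^- k *: G z.

Definition pole (R : realType) (W : normedModType R[i])
    (F : R[i] -> W) (a : R[i]) : Prop :=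
  exists (k : nat) (G : R[i] -> W),
    [/\ holomorphic_at G a, G a != 0 &
        \forall z \near (a : R[i]^o)^', F z = (z - a) ^- k.+1 *: G z].

Definition discrete_subgroup (R : realType) (G : set R[i]) : Prop :=
  [/\ G 0,
      forall a b, G a -> G b -> G (a - b) &
      forall a, G a -> \forall z \near (a : R[i]^o)^', ~ G z].

(* The largest number of Z-linearly independent elements is one. *)
Definition rank_one (R : realType) (G : set R[i]) : Prop :=
  (exists2 a, G a & a != 0) /\
  forall a b, G a -> G b ->
    exists m n : int, ((m != 0) || (n != 0)) /\ a *~ m + b *~ n = 0.

Record is_lie_bracket (R : realType) (g : vectType R[i])
    (br : g -> g -> g) : Prop := IsLieBracket {
  lie_linear_l : forall y, linear (br^~ y);
  lie_linear_r : forall x, linear (br x);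
  lie_alt : forall x, br x x = 0;
  lie_jacobi : forall x y z, br x (br y z) + br y (br z x) + br z (br x y) = 0
}.

Definition lie_ideal (R : realType) (g : vectType R[i])
    (br : g -> g -> g) (J : {vspace g}) : Prop :=
  forall x y, y \in J -> br x y \in J.

Definition simple_lie (R : realType) (g : vectType R[i])
    (br : g -> g -> g) : Prop :=
  [/\ is_lie_bracket br,
      exists x y, br x y != 0 &
      forall J : {vspace g}, lie_ideal br J -> J = 0%VS \/ J = {:g}%VS].

Definition lie_automorphism (R : realType) (g : vectType R[i])
    (br : g -> g -> g) (f : 'End(g)) : Prop :=
  lker f = 0%VS /\ forall x y, f (br x y) = br (f x) (f y).

Definition vb (R : realType) (g : vectType R[i]) (i : 'I_(\dim {:g})) : g :=
  (vbasis {:g})`_i.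

Definition cb (R : realType) (g : vectType R[i]) (i : 'I_(\dim {:g})) (x : g) :
  R[i] := coord (vbasis {:g}) i x.

(* Rows are images of basis vectors, as for [mxof]. *)
Definition end_mx (R : realType) (g : vectType R[i]) (f : 'End(g)) :
  'M[R[i]]_(\dim {:g}) := \matrix_(i, j) cb j (f (vb i)).

Definition killing (R : realType) (g : vectType R[i])
    (br : g -> g -> g) (x y : g) : R[i] :=
  \tr (end_mx (linfun (br x) \o linfun (br y))%VF).

(* Tensors are given by their coordinates in the basis e := vbasis {:g}: the
   matrix A stands for \sum_(i, j) A i j (e_i (x) e_j), so that \rank A is the
   rank of the tensor A; similarly for the third tensor power. *)
Definition tensor3 (R : realType) (g : vectType R[i]) :=
  {ffun 'I_(\dim {:g}) * 'I_(\dim {:g}) * 'I_(\dim {:g}) -> R[i]}.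

Definition tens (R : realType) (g : vectType R[i]) (x y : g) :
  'M[R[i]]_(\dim {:g}) :=
  \matrix_(i, j) (cb i x * cb j y).

Definition tens3 (R : realType) (g : vectType R[i]) (x y z : g) : tensor3 g :=
  [ffun t => cb t.1.1 x * cb t.1.2 y * cb t.2 z].

Definition tensor_map (R : realType) (g : vectType R[i]) (f h : 'End(g))
    (A : 'M[R[i]]_(\dim {:g})) : 'M[R[i]]_(\dim {:g}) :=
  \sum_i \sum_j A i j *: tens (f (vb i)) (h (vb j)).

(* brab_cd br A B is [A^{ab}, B^{cd}], expanded on e_i (x) e_j and e_k (x) e_l. *)
Definition br12_13 (R : realType) (g : vectType R[i]) (br : g -> g -> g)
    (A B : 'M[R[i]]_(\dim {:g})) : tensor3 g :=
  \sum_i \sum_j \sum_k \sum_l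
    (A i j * B k l) *: tens3 (br (vb i) (vb k)) (vb j) (vb l).

Definition br12_23 (R : realType) (g : vectType R[i]) (br : g -> g -> g)
    (A B : 'M[R[i]]_(\dim {:g})) : tensor3 g :=
  \sum_i \sum_j \sum_k \sum_l
    (A i j * B k l) *: tens3 (vb i) (br (vb j) (vb k)) (vb l).

Definition br13_23 (R : realType) (g : vectType R[i]) (br : g -> g -> g)
    (A B : 'M[R[i]]_(\dim {:g})) : tensor3 g :=
  \sum_i \sum_j \sum_k \sum_l
    (A i j * B k l) *: tens3 (vb i) (vb k) (br (vb j) (vb l)).

Definition quadratic_casimir (R : realType) (g : vectType R[i])
    (br : g -> g -> g) (Omega : 'M[R[i]]_(\dim {:g})) : Prop :=
  exists I : (\dim {:g}).-tuple g,
    [/\ basis_of {:g} I,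
        forall i j : 'I_(\dim {:g}), killing br I`_i I`_j = (i == j)%:R &
        Omega = \sum_(i < \dim {:g}) tens I`_i I`_i].

(* A matrix over {poly {poly R[i]}} is a polynomial in two variables with
   coefficients in g (x) g. *)
Definition quasi_trig_fun (R : realType) (g : vectType R[i])
    (Omega : 'M[R[i]]_(\dim {:g}))
    (p : 'M[{poly {poly R[i]}}]_(\dim {:g}))
    (u v : R[i]) : 'M[R[i]]_(\dim {:g}) :=
  (v / (u - v)) *: Omega + map_mx (fun q => q.[u, v]) p.

(* The transpose is the flip of the two tensor factors: A^T = A^{21}. *)
Definition cybe_two_param (R : realType) (g : vectType R[i])
    (br : g -> g -> g) (X : R[i] -> R[i] -> 'M[R[i]]_(\dim {:g})) : Prop :=
  (forall u1 u2 u3, u1 != u2 -> u1 != u3 -> u2 != u3 ->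
     br12_13 br (X u1 u2) (X u1 u3) + br12_23 br (X u1 u2) (X u2 u3)
     + br13_23 br (X u1 u3) (X u2 u3) = 0) /\
  (forall u v, u != v -> X u v = - (X v u)^T).

(* A function meromorphic at 0 is regular on a punctured neighbourhood of 0. *)
Definition cybe_one_param (R : realType) (g : vectType R[i])
    (br : g -> g -> g) (Z : R[i] -> 'M[R[i]]_(\dim {:g})) : Prop :=
  meromorphic_at Z 0 /\
  \forall l \near (0 : R[i]^o) & m \near (0 : R[i]^o),
    l != 0 -> m != 0 -> l + m != 0 ->
    br12_13 br (Z l) (Z (l + m)) + br12_23 br (Z l) (Z m)
    + br13_23 br (Z (l + m)) (Z m) = 0.

(* For a function meromorphic near 0, the exceptional points of a generic
   property are isolated, so it holds on a punctured neighbourhood of 0. *)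
Definition nondegenerate (R : realType) (g : vectType R[i])
    (Z : R[i] -> 'M[R[i]]_(\dim {:g})) : Prop :=
  \forall l \near (0 : R[i]^o)^', \rank (Z l) = \dim {:g}.

Definition trigonometric (R : realType) (g : vectType R[i])
    (br : g -> g -> g) (Z : R[i] -> 'M[R[i]]_(\dim {:g})) : Prop :=
  [/\ cybe_one_param br Z, nondegenerate Z &
      exists Zext : R[i] -> 'M[R[i]]_(\dim {:g}),
        [/\ forall a, meromorphic_at Zext a,
            \forall l \near (0 : R[i]^o)^', Zext l = Z l,
            discrete_subgroup [set a | pole Zext a] &
            rank_one [set a | pole Zext a]]].

(* Main.v *)
Require Import Defs.
From HB Require Import structures.
From mathcomp Require Import all_boot all_order all_algebra.
From mathcomp Require Import complex.
From mathcomp Require Import all_classical all_reals all_analysis.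
From mathcomp Require Import ring lra.
Set Implicit Arguments.
Unset Strict Implicit.
Unset Printing Implicit Defensive.
Import Order.TTheory GRing.Theory Num.Theory numFieldNormedType.Exports.
Import Normc.
Local Open Scope classical_set_scope.
Local Open Scope ring_scope.
Local Open Scope complex_scope.

(** Contracting the Yang-Baxter equation with the bracket in its last two
    factors and letting the last two spectral parameters coincide gives
      v dX/dv = (1 (x) ad h(v)) X - Q(X, X),   h(v) = bracket of p(v, v),
    where Q is symmetric under the flip and the residue Omega contributes X
    itself, the Casimir element being the identity in the adjoint
    representation. By skew-symmetry the first variable satisfies the flipped
    equation, and the quadratic terms cancel in the sum: X moves under
    simultaneous dilation (u, v) -> (e^t u, e^t v) by the infinitesimal
    automorphisms ad h(u), ad h(v) (X_euler).

    This motion is undone by a gauge transformation. In the coordinate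
    z = e^w the linear equation F' = F ad h(e^w) has entire coefficients, so
    its solution F, with inverse G, is entire; it takes values in the
    automorphisms because ad h is a derivation (gauge_aut). After the gauge
    transformation X(e^a, e^b) is invariant under simultaneous translation of
    a and b, hence depends on a - b only (gauge_difference). Setting b = 0, it
    is Zext(w) = (G(w) (x) 1) X(e^w, 1), and Psi(z) = F(log z).

    The second assertion needs no extension argument, since Zext is defined on
    the whole plane: it is X(e^w, 1) multiplied by an entire invertible factor,
    so its poles are those of 1 / (e^w - 1), namely 2 pi i Z, all simple with
    nondegenerate residue. The one-parameter equation is the two-parameter one
    at (e^(l+m), e^m, 1), transported by automorphisms (cybe_aut).

    The analysis is done with complex power series: differentiation inside the
    disc (psum_cder), the Cauchy product (psum_mul), the identification of the
    exponential with its series (cexp_psum), the logarithm near 1 (clogK), and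
    the power series solution of a linear differential equation with entire
    coefficients (ode_coef_entire, mpsum_ode_cder). Tensors are handled through
    the matrices str_mx a of the coordinates of the bracket. *)

(** * The modulus of a complex number and limits *)

Section NormC.
Variable R : realType.
Implicit Types (z w : R[i]).

Lemma normc_norm z : `|z| = (normc z)%:C.
Proof. by case: z. Qed.

Lemma normc_ge0 z : 0 <= normc z.
Proof. by case: z => a b; exact: sqrtr_ge0. Qed.

Lemma normcD z w : normc (z + w) <= normc z + normc w.
Proof. exact: le_normcD. Qed.

Lemma normcB z w : normc (z - w) = normc (w - z).
Proof. by rewrite -normcN opprB. Qed.

Lemma normcX z n : normc (z ^+ n) = normc z ^+ n.
Proof. by elim: n => [|n IH]; rewrite ?expr0 ?normc1 // !exprS normcM IH. Qed.

Lemma normc_real (x : R) : normc x%:C = `|x|.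
Proof. by rewrite /= expr0n addr0 sqrtr_sqr. Qed.

Lemma normc_nat n : normc (n%:R : R[i]) = n%:R.
Proof.
have -> : (n%:R : R[i]) = (n%:R : R)%:C by rewrite rmorph_nat.
by rewrite normc_real ger0_norm.
Qed.

Lemma normc_sum (I : Type) (r : seq I) (P : pred I) (F : I -> R[i]) :
  normc (\sum_(i <- r | P i) F i) <= \sum_(i <- r | P i) normc (F i).
Proof.
elim/big_rec2: _ => [|i y x _ le_xy]; first by rewrite normc0.
exact: le_trans (normcD _ _) (lerD (lexx _) le_xy).
Qed.

Lemma normc_gt0 z : (0 < normc z) = (z != 0).
Proof.
rewrite lt_neqAle normc_ge0 andbT eq_sym; congr (~~ _).
by apply/eqP/eqP => [/eq0_normc|->]; rewrite ?normc0.
Qed.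

Lemma Re_le_normc z : `|complex.Re z| <= normc z.
Proof. by case: z => a b /=; rewrite -sqrtr_sqr ler_sqrt ?lerDl ?sqr_ge0 // addr_ge0 ?sqr_ge0. Qed.

Lemma Im_le_normc z : `|complex.Im z| <= normc z.
Proof. by case: z => a b /=; rewrite -sqrtr_sqr ler_sqrt ?lerDr ?sqr_ge0 // addr_ge0 ?sqr_ge0. Qed.

Lemma normc_le_ReIm z : normc z <= `|complex.Re z| + `|complex.Im z|.
Proof.
case: z => a b /=; have ab0 : 0 <= `|a| + `|b| by rewrite addr_ge0.
rewrite -[leRHS](ger0_norm ab0) -[leRHS]sqrtr_sqr ler_sqrt ?sqr_ge0 //.
by rewrite sqrrD !real_normK ?num_real // lerD2r lerDl mulrn_wge0 ?mulr_ge0.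
Qed.

Lemma ltC0 (e : R[i]) : 0 < e -> 0 < complex.Re e /\ e = (complex.Re e)%:C.
Proof.
by case: e => a b; rewrite ltcE /= => /andP[/eqP -> a0].
Qed.

(** The order of R[i] is partial, so neighbourhoods are described by real radii. *)
Lemma near_normcP (a : R[i]) (P : set R[i]) :
  (\forall z \near (a : R[i]^o), P z) <->
  exists2 d : R, 0 < d & forall z, normc (z - a) < d -> P z.
Proof.
split.
  move/nbhs_ballP => [e /= /ltC0[e0 ee] H]; exists (complex.Re e) => // z Hz.
  by apply: H; rewrite /ball /= normc_norm ee ltcR normcB.
move=> [d d0 H]; apply/nbhs_ballP; exists d%:C => /=; first by rewrite ltcR.
by move=> z; rewrite /ball /= normc_norm ltcR normcB => /H.
Qed.

Lemma near_normc_punctured (a : R[i]) (P : set R[i]) :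
  (\forall z \near (a : R[i]^o)^', P z) <->
  exists2 d : R, 0 < d & forall z, normc (z - a) < d -> z != a -> P z.
Proof.
exact: (near_normcP a (fun z => z != a -> P z)).
Qed.

Lemma cvgCP (u : nat -> R[i]) (l : R[i]) :
  (u @ \oo --> (l : R[i]^o)) <-> ((fun n => normc (u n - l)) @ \oo --> (0 : R)).
Proof.
split.
  move=> /(@cvgrPdist_le R[i] R[i]^o nat \oo _ u l) H; apply/cvgr0Pnorm_le => e e0.
  have /H : (0 : R[i]) < e%:C by rewrite ltcR.
  apply: filterS => n H1; rewrite ger0_norm ?normc_ge0 //.
  by rewrite normcB -lecR -normc_norm.
move=> /cvgr0Pnorm_le H; apply/(@cvgrPdist_le R[i] R[i]^o nat \oo _ u l) => e /ltC0[e0 ->].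
apply: filterS (H _ e0) => n; rewrite ger0_norm ?normc_ge0 //.
by rewrite normcB -lecR -normc_norm.
Qed.

Lemma cvgC_squeeze (u : nat -> R[i]) (l : R[i]) (v : nat -> R) :
  (forall n, normc (u n - l) <= v n) -> v @ \oo --> (0 : R) ->
  u @ \oo --> (l : R[i]^o).
Proof.
move=> uv v0; apply/cvgCP; apply: (squeeze_cvgr _ (cvg_cst (0 : R)) v0).
by near=> n; rewrite normc_ge0 uv.
Unshelve. all: by end_near. Qed.

Lemma cvgC_ReIm (u : nat -> R[i]) (x y : R) :
  (fun n => complex.Re (u n)) @ \oo --> x ->
  (fun n => complex.Im (u n)) @ \oo --> y ->
  u @ \oo --> ((x +i* y) : R[i]^o).
Proof.
move=> ux uy; pose v n := `|complex.Re (u n) - x| + `|complex.Im (u n) - y|.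
apply: (@cvgC_squeeze _ _ v).
  move=> n; apply: le_trans (normc_le_ReIm _) _; rewrite /v.
  by case: (u n) => a b /=.
rewrite -[0 : R]addr0; apply: cvgD.
  by rewrite -(@normr0 _ R) -(subrr x); apply: cvg_norm; apply: cvgB => //; exact: cvg_cst.
by rewrite -(@normr0 _ R) -(subrr y); apply: cvg_norm; apply: cvgB => //; exact: cvg_cst.
Qed.

Lemma cvgC_bound (u : nat -> R[i]) (l : R[i]) (B : R) :
  u @ \oo --> (l : R[i]^o) -> (forall n, normc (u n) <= B) -> normc l <= B.
Proof.
move=> /cvgCP ul uB; apply/ler_addgt0Pr => e e0.
have /cvgr0Pnorm_lt/(_ _ e0) [n _ /(_ n (leqnn _))] := ul.
rewrite /= ger0_norm ?normc_ge0 // => H.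
rewrite -[l](subrK (u n)) addrC; apply: le_trans (normcD _ _) _.
by rewrite lerD ?uB // normcB ltW.
Qed.

End NormC.

(** * Complex derivatives *)

Lemma is_derive_chain (K : numFieldType) (f g : K -> K) (z d e : K) :
  is_derive z (1 : K) g d -> is_derive (g z) (1 : K) f e ->
  is_derive z (1 : K) (f \o g) (e * d).
Proof.
move=> [dg <-] [df <-].
have Dg := (derivable1_diffP _ _).1 dg; have Df := (derivable1_diffP _ _).1 df.
split; first exact/derivable1_diffP/differentiable_comp.
rewrite -!derive1E derive1E'; last exact: differentiable_comp.
rewrite diff_comp // !derive1E' //= -[X in 'd _ _ X = _]mulr1.
by rewrite [LHS]linearZ mulrC.
Qed.

Section ComplexDerivative.
Variable R : realType.
Implicit Types (f g : R[i] -> R[i]) (z w d e : R[i]).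

(** Complex differentiability: R[i] is seen as a normed space over itself. *)
Definition cder f z d := is_derive (z : R[i]^o) (1 : R[i]^o) (f : R[i]^o -> R[i]^o) d.

Lemma cder_eq f z d e : cder f z d -> d = e -> cder f z e.
Proof. by move=> H <-. Qed.

Lemma cder_unique f z d e : cder f z d -> cder f z e -> d = e.
Proof. by move=> [_ <-] [_ <-]. Qed.

Lemma cder_ext f g z d : (forall x, f x = g x) -> cder f z d -> cder g z d.
Proof. by move=> fg; have -> : f = g by apply/funext. Qed.

Lemma cder_near f g z d (r : R) : 0 < r ->
  (forall x, normc (x - z) < r -> f x = g x) -> cder f z d -> cder g z d.
Proof.
move=> r0 fg; apply: near_eq_is_derive.
by apply/near_normcP; exists r.
Qed.

Lemma cder_cst c z : cder (fun=> c) z 0.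
Proof. exact: is_derive_cst. Qed.

Lemma cder_id z : cder id z 1.
Proof. exact: is_derive_id. Qed.

Lemma cderD f g z d e : cder f z d -> cder g z e -> cder (fun x => f x + g x) z (d + e).
Proof. exact: is_deriveD. Qed.

Lemma cderN f z d : cder f z d -> cder (fun x => - f x) z (- d).
Proof. exact: is_deriveN. Qed.

Lemma cderB f g z d e : cder f z d -> cder g z e -> cder (fun x => f x - g x) z (d - e).
Proof. exact: is_deriveB. Qed.

Lemma cderM f g z d e : cder f z d -> cder g z e ->
  cder (fun x => f x * g x) z (d * g z + f z * e).
Proof.
move=> df dg; apply: (@cder_eq _ _ (f z * e + g z * d)).
  exact: (@is_deriveM R[i] R[i]^o f g z 1 d e).
by rewrite addrC mulrC.
Qed.

Lemma cder_sum n (F : 'I_n -> R[i] -> R[i]) z (d : 'I_n -> R[i]) :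
  (forall i, cder (F i) z (d i)) -> cder (fun x => \sum_i F i x) z (\sum_i d i).
Proof.
elim: n F d => [|n IH] F d H.
  apply: (@cder_ext (fun=> 0)) => [x|]; rewrite ?big_ord0 //; exact: cder_cst.
apply: (@cder_ext (fun x => \sum_i F (widen_ord (leqnSn n) i) x + F ord_max x)).
  by move=> x; rewrite big_ord_recr.
by rewrite big_ord_recr; apply: cderD => //; apply: IH => i.
Qed.

Lemma cderV f z d : f z != 0 -> cder f z d ->
  cder (fun x => (f x)^-1) z (- (f z ^- 2 * d)).
Proof.
move=> fz [df <-]; split; first exact: (@derivableV R[i] R[i]^o).
by rewrite (@deriveV R[i] R[i]^o) // scaleNr.
Qed.

Lemma cder_comp f g z d e : cder g z d -> cder f (g z) e ->
  cder (fun x => f (g x)) z (e * d).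
Proof. exact: is_derive_chain. Qed.

Lemma cderP f z d : cder f z d <->
  forall e : R, 0 < e -> exists2 r, 0 < r &
    forall h, normc h < r -> normc (f (z + h) - f z - d * h) <= e * normc h.
Proof.
split.
  move=> [/cvg_ex[l fl]]; rewrite /derive (cvg_lim _ fl) // => <- e e0.
  have /(@cvgrPdist_le R[i] R[i]^o R[i]^o (0^') _ _ l)/(_ e%:C) := fl.
  rewrite ltcR e0 => /(_ isT)/near_normc_punctured[r r0 H].
  exists r => // h hr; have [->|h0] := eqVneq h 0.
    by rewrite addr0 subrr mulr0 subrr normc0 mulr0.
  have := H h; rewrite subr0 => /(_ hr h0) /=.
  rewrite [X in X <= _](_ : _ = (normc (l - h^-1 * (f (h * 1 + z) - f z)))%:C) ?normc_norm //.
  rewrite lecR normcB mulr1 (addrC h) => H1.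
  rewrite -[X in normc (_ - X)](mulrC h) -[f _ - f _](mulVKf h0) -mulrBr normcM mulrC.
  by rewrite ler_wpM2r ?normc_ge0.
move=> H.
have fl : (h^-1 * (f (h * 1 + z) - f z) @[h --> (0 : R[i]^o)^']) --> (d : R[i]^o).
  apply/(@cvgrPdist_le R[i] R[i]^o R[i]^o (0^') _ _ d) => e /ltC0[e0 ->].
  have [r r0 Hr] := H _ e0; apply/near_normc_punctured; exists r => // h.
  rewrite subr0 => hr h0; rewrite mulr1 (addrC h).
  rewrite [X in X <= _](_ : _ = (normc (d - h^-1 * (f (z + h) - f z)))%:C) ?normc_norm //.
  rewrite lecR normcB -(ler_pM2l (x := normc h)) ?normc_gt0 // -normcM mulrBr mulVKf //.
  by rewrite (mulrC h) (mulrC (normc h)) Hr.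
split; first by apply/cvg_ex; exists d.
exact: (cvg_lim (@norm_hausdorff _ R[i]^o) fl).
Qed.

(** A second-order remainder estimate is the form in which power series deliver
    their derivative. *)
Lemma cder_quadratic f z d (K r : R) : 0 < r ->
  (forall h, normc h < r -> normc (f (z + h) - f z - d * h) <= K * normc h ^+ 2) ->
  cder f z d.
Proof.
move=> r0 H; apply/cderP => e e0.
have K1 : 0 < `|K| + 1 by rewrite ltr_wpDl.
exists (Num.min r (e / (`|K| + 1))).
  by rewrite lt_min r0 divr_gt0.
move=> h; rewrite lt_min => /andP[hr he]; apply: le_trans (H _ hr) _.
rewrite expr2 mulrA ler_wpM2r ?normc_ge0 //.
apply: (@le_trans _ _ ((`|K| + 1) * normc h)).
  by rewrite ler_wpM2r ?normc_ge0 // (le_trans (ler_norm _)) // lerDl.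
by rewrite mulrC -ler_pdivlMr // ltW.
Qed.

Lemma cder_continuous f z d : cder f z d ->
  forall e : R, 0 < e -> exists2 r, 0 < r &
    forall x, normc (x - z) < r -> normc (f x - f z) < e.
Proof.
move=> /cderP/(_ 1 ltr01)[r r0 H] e e0.
have d1 : 0 < 1 + normc d by rewrite ltr_pwDl ?normc_ge0.
exists (Num.min r (e / (1 + normc d))); first by rewrite lt_min r0 divr_gt0.
move=> x; rewrite lt_min => /andP[xr xe].
have := H _ xr; rewrite mul1r [z + _]addrC subrK => Hx.
rewrite -[f x - f z](subrK (d * (x - z))).
apply: le_lt_trans (normcD _ _) _; rewrite normcM.
apply: (@le_lt_trans _ _ ((1 + normc d) * normc (x - z))).
  by rewrite mulrDl mul1r lerD2r.
by rewrite mulrC -ltr_pdivlMr.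
Qed.

(** Along a real segment the real and imaginary parts have vanishing real
    derivative, so the mean value theorem applies to each. *)
Lemma cder0_segment f a b :
  (forall t : R, 0 <= t <= 1 -> cder f (a + t%:C * (b - a)) 0) -> f a = f b.
Proof.
move=> H; pose h := b - a.
have part (p : R[i] -> R) : {morph p : x y / x - y} ->
    (forall x, `|p x| <= normc x) -> p (f a) = p (f b).
  move=> pB pn; pose g t := p (f (a + t%:C * h)).
  have dg (t : R) : 0 <= t <= 1 -> is_derive t 1 (g : R -> R) 0.
    move=> t01.
    have gl : (s^-1 * (g (s * 1 + t) - g t) @[s --> (0 : R)^']) --> (0 : R).
      apply/cvgr0Pnorm_le => e e0.
      have h1 : 0 < normc h + 1 by rewrite ltr_wpDl ?normc_ge0.
      have [r r0 Hr] := (cderP _ _ _).1 (H _ t01) _ (divr_gt0 e0 h1).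
      near=> s; rewrite /= normrM normfV.
      have s0 : s != 0 by near: s; exact: nbhs_dnbhs_neq.
      rewrite ler_pdivrMl ?normr_gt0 // mulr1 /g -pB.
      apply: le_trans (pn _) _.
      have sr : normc (s%:C * h) < r.
        rewrite normcM normc_real.
        apply: (@le_lt_trans _ _ (`|s| * (normc h + 1))); first by rewrite ler_wpM2l ?lerDl.
        rewrite -ltr_pdivlMr //; near: s; apply: dnbhs0_lt; exact: divr_gt0.
      have := Hr _ sr; rewrite mul0r subr0 -addrA -mulrDl -rmorphD (addrC t) => H1.
      apply: le_trans H1 _; rewrite normcM normc_real mulrCA ler_wpM2l //.
      by rewrite mulrAC ler_pdivrMr // ler_wpM2l ?lerDl // ltW.
    split; first by apply/cvg_ex; exists 0.
    exact: cvg_lim gl.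
  have dg' (t : R) : t \in `]0, 1[ -> is_derive t 1 g 0.
    by rewrite in_itv /= => /andP[t0 t1]; apply: dg; rewrite !ltW.
  have cg : {within `[0, 1], continuous g}.
    apply: derivable_within_continuous => t; rewrite in_itv /= => t01.
    by have [] := dg t t01.
  have [t _] := @MVT_segment R g (fun=> 0) 0 1 ler01 dg' cg.
  rewrite mul0r /g mul1r mul0r addr0 /h (addrC a) subrK => /eqP.
  by rewrite subr_eq0 => /eqP.
apply/eqP; rewrite eq_complex; apply/andP; split; apply/eqP.
  by apply: part => [x y|]; [exact: (raddfB (@complex.Re R)) | exact: Re_le_normc].
by apply: part => [x y|]; [exact: (raddfB (@complex.Im R)) | exact: Im_le_normc].
Unshelve. all: by end_near. Qed.

Lemma cder0_const f : (forall z, cder f z 0) -> forall a b, f a = f b.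
Proof. by move=> H a b; apply: cder0_segment. Qed.

End ComplexDerivative.

(** * Power series *)

Section ComplexLimits.
Variable R : realType.
Implicit Types (u v : nat -> R[i]) (a b c : R[i]).

Lemma cvgCD u v a b : u @ \oo --> (a : R[i]^o) -> v @ \oo --> (b : R[i]^o) ->
  (fun n => u n + v n) @ \oo --> (a + b : R[i]^o).
Proof. exact: (@cvgD R[i] R[i]^o nat \oo _ u v a b). Qed.

Lemma cvgCM u v a b : u @ \oo --> (a : R[i]^o) -> v @ \oo --> (b : R[i]^o) ->
  (fun n => u n * v n) @ \oo --> (a * b : R[i]^o).
Proof. exact: (@cvgM R[i] nat \oo _ u v a b). Qed.

Lemma cvgC_cst c : (fun _ : nat => c) @ \oo --> (c : R[i]^o).
Proof. exact: (@cvg_cst R[i]^o c nat \oo _). Qed.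

Lemma cvgC_ext u v a : (forall n, u n = v n) -> u @ \oo --> (a : R[i]^o) ->
  v @ \oo --> (a : R[i]^o).
Proof. by move=> uv; have -> : u = v by apply/funext. Qed.

Lemma cvgC_shiftS u a :
  ((fun n => u n.+1) @ \oo --> (a : R[i]^o)) <-> (u @ \oo --> (a : R[i]^o)).
Proof. by have -> := @cvg_shiftS R[i]^o u (nbhs (a : R[i]^o)). Qed.

End ComplexLimits.
Arguments cvgC_cst {R} c.

Section PowerSeries.
Variable R : realType.
Implicit Types (a b : nat -> R[i]) (z w : R[i]) (r s : R).

(** By comparison with a geometric series this bound gives absolute convergence
    on the open disc of radius r; it is easier to carry around than a radius of
    convergence. *)
Definition coef_bounded a r := exists M, forall n, normc (a n) * r ^+ n <= M.

Definition psum a z : R[i] :=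
  limn (series (fun n => a n * z ^+ n) : nat -> R[i]^o).

Definition pdiff a n : R[i] := a n.+1 * n.+1%:R.

Definition pconv a b n : R[i] := \sum_(k < n.+1) a k * b (n - k)%N.

Lemma coef_bounded_ge0 a r : coef_bounded a r ->
  exists2 M, 0 <= M & forall n, normc (a n) * r ^+ n <= M.
Proof.
case=> M H; exists `|M| => // n; exact: le_trans (H n) (ler_norm _).
Qed.

Lemma geometric_sum_le (M q : R) n : 0 <= M -> 0 <= q < 1 ->
  \sum_(i < n) M * q ^+ i <= M / (1 - q).
Proof.
move=> M0 /andP[q0 q1]; have q1' : 0 < 1 - q by rewrite subr_gt0.
rewrite -mulr_sumr ler_wpM2l // -[leRHS]mul1r ler_pdivlMr // mulrC.
have -> : (1 - q) * \sum_(i < n) q ^+ i = 1 - q ^+ n.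
  rewrite -[in RHS](expr1n _ n) subrXX; congr (_ * _).
  by apply: eq_bigr => i _; rewrite expr1n mul1r.
by rewrite gerBl exprn_ge0.
Qed.

Lemma coef_bound_term a r M z n : (forall n, normc (a n) * r ^+ n <= M) ->
  0 < r -> normc (a n * z ^+ n) <= M * (normc z / r) ^+ n.
Proof.
move=> H r0; rewrite normcM normcX expr_div_n mulrA mulrAC.
by rewrite ler_wpM2r ?exprn_ge0 ?normc_ge0 // ler_pdivlMr ?exprn_gt0.
Qed.

Lemma ratio_lt1 z r : normc z < r -> 0 <= normc z / r < 1.
Proof.
move=> zr; have r0 : 0 < r by exact: le_lt_trans (normc_ge0 _) zr.
by rewrite divr_ge0 ?normc_ge0 ?(ltW r0) //= ltr_pdivrMr ?mul1r.
Qed.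

Lemma series_ordE (V : zmodType) (u : nat -> V) n : series u n = \sum_(i < n) u i.
Proof. by rewrite /series /= big_mkord. Qed.

(** The real and imaginary parts are dominated by a geometric series; the values
    of the real limits are glued into a complex one. *)
Lemma psum_cvg a r z : coef_bounded a r -> normc z < r ->
  series (fun n => a n * z ^+ n) @ \oo --> (psum a z : R[i]^o).
Proof.
move=> /coef_bounded_ge0[M M0 HM] zr.
have r0 : 0 < r by exact: le_lt_trans (normc_ge0 _) zr.
have /andP[q0 q1] := ratio_lt1 zr.
have conv (u : nat -> R) : (forall n, `|u n| <= normc (a n * z ^+ n)) ->
    cvgn (series u).
  move=> Hu; apply: normed_cvg.
  apply: (@series_le_cvg R _ (geometric M (normc z / r))) => [n|n|n|] //=.
  - by rewrite mulr_ge0 ?exprn_ge0.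
  - exact: (le_trans (Hu n) (coef_bound_term z n HM r0)).
  - by apply: is_cvg_geometric_series; rewrite ger0_norm.
have cR := conv (fun n => complex.Re (a n * z ^+ n)) (fun n => Re_le_normc _).
have cI := conv (fun n => complex.Im (a n * z ^+ n)) (fun n => Im_le_normc _).
suff H : series (fun n => a n * z ^+ n) @ \oo -->
    (limn (series (fun n => complex.Re (a n * z ^+ n))) +i*
     limn (series (fun n => complex.Im (a n * z ^+ n))) : R[i]^o).
  by rewrite /psum (cvg_lim (@norm_hausdorff _ R[i]^o) H).
apply: cvgC_ReIm.
  rewrite [X in X @ \oo --> _](_ : _ = series (fun n => complex.Re (a n * z ^+ n))) //.
  by apply/funext => n; rewrite !series_ordE (raddf_sum (@complex.Re R)).
rewrite [X in X @ \oo --> _](_ : _ = series (fun n => complex.Im (a n * z ^+ n))) //.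
by apply/funext => n; rewrite !series_ordE (raddf_sum (@complex.Im R)).
Qed.

Lemma psum_eq a z l : series (fun n => a n * z ^+ n) @ \oo --> (l : R[i]^o) ->
  psum a z = l.
Proof. exact: (cvg_lim (@norm_hausdorff _ R[i]^o)). Qed.

Lemma psum0 a : psum a 0 = a 0%N.
Proof.
apply: psum_eq; apply: (@cvgC_squeeze _ _ _ (fun n => normc (a 0%N) * 0 ^+ n)).
  case=> [|n]; rewrite series_ordE.
    by rewrite big_ord0 sub0r normcN expr0 mulr1.
  rewrite big_ord_recl expr0 mulr1 big1 => [|i _]; last by rewrite exprS mul0r mulr0.
  by rewrite addr0 subrr normc0 exprS mul0r mulr0.
by apply: (cvg_geometric (normc (a 0%N))); rewrite normr0.
Qed.

Lemma psumD a b r z : coef_bounded a r -> coef_bounded b r -> normc z < r ->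
  psum (fun n => a n + b n) z = psum a z + psum b z.
Proof.
move=> ar br zr; apply: psum_eq.
apply: (cvgC_ext _ (cvgCD (psum_cvg ar zr) (psum_cvg br zr))) => n.
by rewrite !series_ordE -big_split /=; apply: eq_bigr => i _; rewrite mulrDl.
Qed.

Lemma psumZ c a r z : coef_bounded a r -> normc z < r ->
  psum (fun n => c * a n) z = c * psum a z.
Proof.
move=> ar zr; apply: psum_eq.
apply: (cvgC_ext _ (cvgCM (cvgC_cst c) (psum_cvg ar zr))) => n.
by rewrite !series_ordE mulr_sumr; apply: eq_bigr => i _; rewrite mulrA.
Qed.

Lemma psum_shift a r z : coef_bounded a r -> coef_bounded (fun n => a n.+1) r ->
  normc z < r -> psum a z = a 0%N + z * psum (fun n => a n.+1) z.
Proof.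
move=> ar br zr; apply/psum_eq/cvgC_shiftS.
apply: (cvgC_ext _ (cvgCD (cvgC_cst _) (cvgCM (cvgC_cst z) (psum_cvg br zr)))) => n.
rewrite !series_ordE mulr_sumr big_ord_recl expr0 mulr1.
by congr (_ + _); apply: eq_bigr => i _; rewrite exprS mulrCA.
Qed.

(** Induction on n: the ratio p is traded for the larger ratio s. *)
Lemma expn_mul_geometric (p s : R) n : 0 <= p -> p < s -> s < 1 ->
  n%:R * p ^+ n <= (s - p)^-1 * s ^+ n.
Proof.
move=> p0 ps s1; have sp : 0 < s - p by rewrite subr_gt0.
suff H : (s - p) * (n%:R * p ^+ n) <= s ^+ n by rewrite ler_pdivlMl.
elim: n => [|n IH]; first by rewrite !mul0r mulr0.
have -> : (s - p) * (n.+1%:R * p ^+ n.+1) =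
    p * ((s - p) * (n%:R * p ^+ n)) + (s - p) * p ^+ n.+1.
  by rewrite -natr1 exprS; ring.
have -> : s ^+ n.+1 = p * s ^+ n + (s - p) * s ^+ n by rewrite exprS; ring.
rewrite lerD // ?ler_wpM2l // ?(ltW sp) //.
apply: (@le_trans _ _ (p ^+ n)).
  by rewrite exprS ler_piMl ?exprn_ge0 // ltW // (lt_trans ps).
by rewrite lerXn2r ?nnegrE ?(ltW ps) // (le_trans p0) ?ltW.
Qed.

(** A polynomial factor costs an arbitrarily small part of the radius. *)
Lemma coef_bounded_natM a r s : coef_bounded a r -> 0 < s -> s < r ->
  coef_bounded (fun n => a n * n%:R) s.
Proof.
move=> /coef_bounded_ge0[M M0 H] s0 sr.
have r0 : 0 < r by exact: lt_trans sr.
pose t := (s / r + 1) / 2.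
have q1 : s / r < 1 by rewrite ltr_pdivrMr ?mul1r.
have q0 : 0 <= s / r by rewrite divr_ge0 ?ltW.
have qt : s / r < t by rewrite /t; lra.
have t1 : t < 1 by rewrite /t; lra.
exists (M * (t - s / r)^-1) => n; rewrite normcM normc_nat.
have -> : s ^+ n = r ^+ n * (s / r) ^+ n by rewrite -exprMn mulrCA divff ?mulr1 ?gt_eqF.
rewrite mulrA [X in X * _](_ : _ = normc (a n) * r ^+ n * n%:R); last by ring.
rewrite -mulrA.
apply: ler_pM => //; rewrite ?mulr_ge0 ?exprn_ge0 ?normc_ge0 ?(ltW r0) //.
apply: le_trans (expn_mul_geometric n q0 qt t1) _.
rewrite ler_piMr ?invr_ge0 ?subr_ge0 ?(ltW qt) // exprn_ile1 ?(ltW t1) //.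
by rewrite (le_trans q0) // ltW.
Qed.

Lemma coef_bounded_shift a r : 0 < r -> coef_bounded a r ->
  coef_bounded (fun n => a n.+1) r.
Proof.
move=> r0 [M H]; exists (M / r) => n.
by rewrite ler_pdivlMr // -mulrA -exprSr.
Qed.

Lemma coef_bounded_pdiff a r s : coef_bounded a r -> 0 < s -> s < r ->
  coef_bounded (pdiff a) s.
Proof.
by move=> ar s0 sr; apply: (coef_bounded_shift s0 (coef_bounded_natM ar s0 sr)).
Qed.

(** Second-order Taylor remainder of a monomial; both sides carry an extra
    factor rho^2 so that no negative power occurs. *)
Lemma monomial_remainder z h (rho : R) n : normc z + normc h <= rho ->
  normc ((z + h) ^+ n - z ^+ n - n%:R * z ^+ n.-1 * h) * rho ^+ 2 <=
  n%:R ^+ 2 * rho ^+ n * normc h ^+ 2.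
Proof.
move=> zh; have z0 := normc_ge0 z; have h0 := normc_ge0 h.
have rho0 : 0 <= rho by rewrite (le_trans _ zh) ?addr_ge0.
have zrho : normc z <= rho by rewrite (le_trans _ zh) ?lerDl.
elim: n => [|n IH]; first by rewrite !expr0 subrr !mul0r subrr normc0 mul0r expr2 !mul0r.
have -> : (z + h) ^+ n.+1 - z ^+ n.+1 - n.+1%:R * z ^+ n.+1.-1 * h =
   (z + h) * ((z + h) ^+ n - z ^+ n - n%:R * z ^+ n.-1 * h) +
    n%:R * z ^+ n.-1 * h ^+ 2.
  case: n {IH} => [|n]; first by rewrite !expr0; ring.
  by rewrite /= -!natr1 !exprS; ring.
have H2 : normc (n%:R * z ^+ n.-1 * h ^+ 2) * rho ^+ 2 <= n%:R * rho ^+ n.+1 * normc h ^+ 2.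
  case: n {IH} => [|n]; first by rewrite !mul0r normc0 mul0r.
  rewrite !normcM normc_nat !normcX [leLHS]mulrAC ler_wpM2r ?mulr_ge0 // -mulrA.
  rewrite ler_wpM2l //= -(addn2 n) exprD ler_wpM2r ?exprn_ge0 // lerXn2r ?nnegrE //.
apply: le_trans (ler_wpM2r (exprn_ge0 _ rho0) (normcD _ _)) _.
rewrite mulrDl.
apply: (@le_trans _ _ (rho * (n%:R ^+ 2 * rho ^+ n * normc h ^+ 2) +
                       n%:R * rho ^+ n.+1 * normc h ^+ 2)).
  apply: lerD => //; rewrite normcM -[leLHS]mulrA.
  apply: ler_pM => //; rewrite ?mulr_ge0 ?exprn_ge0 ?normc_ge0 //.
  exact: le_trans (normcD _ _) zh.
have -> : rho * (n%:R ^+ 2 * rho ^+ n * normc h ^+ 2) + n%:R * rho ^+ n.+1 * normc h ^+ 2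
  = (n%:R ^+ 2 + n%:R) * (rho ^+ n.+1 * normc h ^+ 2) by rewrite (exprS rho n); ring.
rewrite -[leRHS]mulrA ler_wpM2r ?mulr_ge0 ?exprn_ge0 //.
by rewrite -natr1 sqrrD1 -addrA lerD2l mulr2n -addrA lerDl addr_ge0.
Qed.

(** A power series is differentiated term by term inside its disc. *)
Lemma psum_cder a r z : coef_bounded a r -> normc z < r ->
  cder (psum a) z (psum (pdiff a) z).
Proof.
move=> ar zr; have z0 := normc_ge0 z.
have r0 : 0 < r by exact: le_lt_trans zr.
pose rho := (normc z + r) / 2; pose s := (rho + r) / 2.
have rho0 : 0 < rho by rewrite /rho; lra.
have zrho : normc z < rho by rewrite /rho; lra.
have rhor : rho < r by rewrite /rho; lra.
have rhos : rho < s by rewrite /s; lra.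
have s0 : 0 < s by rewrite /s; lra.
pose t := (s + r) / 2.
have st : s < t by rewrite /t /s; lra.
have tr : t < r by rewrite /t /s; lra.
have at2 := coef_bounded_natM (coef_bounded_natM ar (lt_trans s0 st) tr) s0 st.
have [M M0 HM] := coef_bounded_ge0 at2.
pose q := rho / s.
have q01 : 0 <= q < 1 by rewrite divr_ge0 ?ltW //= ltr_pdivrMr // mul1r.
have pr : coef_bounded (pdiff a) rho := coef_bounded_pdiff ar rho0 rhor.
(* The remainder of the n-th term is at most |a_n| n^2 rho^(n-2) |h|^2, and
   |a_n| n^2 s^n <= M. *)
pose K := M / (1 - q) / rho ^+ 2.
apply: (@cder_quadratic _ _ _ _ K (rho - normc z)); first by rewrite subr_gt0.
move=> h; rewrite ltrBrDl => /ltW zh.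
have zhr : normc (z + h) < r.
  by apply: le_lt_trans rhor; apply: le_trans zh; exact: normcD.
pose T n := a n * ((z + h) ^+ n - z ^+ n - n%:R * z ^+ n.-1 * h).
have cT : (fun n => \sum_(i < n.+1) T i) @ \oo -->
    ((psum a (z + h) - psum a z - psum (pdiff a) z * h) : R[i]^o).
  have c1 := (cvgC_shiftS _ _).2 (psum_cvg ar zhr).
  have c2 := (cvgC_shiftS _ _).2 (psum_cvg ar zr); have c3 := psum_cvg pr zrho.
  have := cvgCD (cvgCD c1 (cvgCM (cvgC_cst (-1)) c2)) (cvgCM (cvgC_cst (- h)) c3).
  rewrite !mulN1r mulNr [h * _]mulrC; apply: cvgC_ext => n /=.
  rewrite !series_ordE mulN1r -[in X in _ + X](add0r (\sum_(i < n) _)).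
  rewrite [0 + _](_ : _ = \sum_(i < n.+1) a i * i%:R * z ^+ i.-1); last first.
    by rewrite big_ord_recl mulr0 mul0r; congr (_ + _); apply: eq_bigr.
  rewrite mulr_sumr -sumrN -!big_split /=; apply: eq_bigr => i _.
  by rewrite /T; ring.
have bT n : normc (\sum_(i < n.+1) T i) <= K * normc h ^+ 2.
  apply: le_trans (normc_sum _ _ _) _.
  apply: (@le_trans _ _ (\sum_(i < n.+1) (M * normc h ^+ 2 / rho ^+ 2) * q ^+ i)); last first.
    have M'0 : 0 <= M * normc h ^+ 2 / rho ^+ 2.
      by apply: divr_ge0; [apply: mulr_ge0 => //|]; apply: exprn_ge0; rewrite ?normc_ge0 ?ltW.
    apply: le_trans (geometric_sum_le n.+1 M'0 q01) _.
    by rewrite le_eqVlt /K; apply/orP; left; apply/eqP; ring.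
  apply: ler_sum => i _; rewrite mulrAC ler_pdivlMr ?exprn_gt0 // /T normcM -[leLHS]mulrA.
  apply: le_trans (ler_wpM2l (normc_ge0 _) (monomial_remainder i zh)) _.
  rewrite [leLHS]mulrA [leRHS]mulrAC ler_wpM2r ?exprn_ge0 ?normc_ge0 // [leLHS]mulrA.
  rewrite /q [(rho / s) ^+ i]expr_div_n [leRHS]mulrA ler_pdivlMr ?exprn_gt0 // [leLHS]mulrAC.
  rewrite ler_wpM2r ?exprn_ge0 ?(ltW rho0) //.
  by apply: le_trans (HM i); rewrite !normcM !normc_nat expr2 mulrA.
exact: cvgC_bound cT bT.
Qed.

End PowerSeries.

(** * The Cauchy product *)

Section CauchyProduct.
Variable R : realType.
Implicit Types (a b : nat -> R[i]) (z w : R[i]) (r s : R).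

(** The antidiagonals n < N fill the triangle below the antidiagonal N. *)
Lemma sum_triangle (F : nat -> nat -> R[i]) N :
  \sum_(n < N) \sum_(k < n.+1) F k (n - k)%N =
  \sum_(i < N) \sum_(j < N | (i + j < N)%N) F i j.
Proof.
elim: N => [|N IH]; first by rewrite !big_ord0.
rewrite big_ord_recr /= IH [RHS]big_ord_recr /=.
have -> : \sum_(j < N.+1 | (N + j < N.+1)%N) F N j = F N 0%N.
  rewrite big_mkcond big_ord_recl /= addn0 ltnSn big1 ?addr0 // => i _.
  by rewrite /bump /= addnS ltnS ltnNge leq_addr.
rewrite [\sum_(k < N.+1) _]big_ord_recr /= subnn addrA; congr (_ + _).
rewrite -big_split /=; apply: eq_bigr => i _.
have iN := ltn_ord i.
rewrite [RHS]big_mkcond big_ord_recr /= (_ : (i + N < N.+1)%N = (i == 0%N :> nat)); last first.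
  by rewrite -[X in (_ < X)%N]add1n ltn_add2r ltnS leqn0.
have lt_sub : (N - i < N.+1)%N by rewrite ltnS leq_subr.
have [i0|i0] := eqVneq (i : nat) 0%N.
  rewrite i0 subn0; congr (_ + _); rewrite [LHS]big_mkcond; apply: eq_bigr => j _.
  by rewrite add0n ltnS (ltnW (ltn_ord j)) ltn_ord.
rewrite addr0 [LHS](_ : _ = \sum_(j < N | (i + j < N)%N) F i j + F i (N - i)%N) //.
have lt_sub' : (N - i < N)%N by rewrite ltn_subrL lt0n i0 (leq_ltn_trans _ iN).
rewrite [LHS]addrC -big_mkcond [RHS](bigD1 (Ordinal lt_sub')) /=; last by rewrite subnKC // ltnW.
congr (_ + _); apply: eq_bigl => j.
rewrite -val_eqE /= ltnS [X in _ = X && _]leq_eqVlt; have [e|ne] := eqVneq (i + j)%N N.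
  have -> : (N - i)%N = j by rewrite -[X in (X - _)%N]e addKn.
  by rewrite e ltnn eqxx.
by case: ltnP => //= lt; apply/esym/eqP => e; rewrite e subnKC ?eqxx ?(ltnW iN) // in ne.
Qed.

(** The product of the partial sums exceeds the partial sum of the product by the
    terms with N <= i + j; there are at most N^2 of them, each O(q^N). *)
Lemma psum_mul a b r z : coef_bounded a r -> coef_bounded b r -> normc z < r ->
  series (fun n => pconv a b n * z ^+ n) @ \oo --> (psum a z * psum b z : R[i]^o).
Proof.
move=> ar br zr; have [M M0 HM] := coef_bounded_ge0 ar.
have [P P0 HP] := coef_bounded_ge0 br.
have r0 : 0 < r by exact: le_lt_trans (normc_ge0 _) zr.
have /andP[q0 q1] := ratio_lt1 zr; set q := normc z / r in q0 q1.
pose t := (q + 1) / 2; pose t' := (t + 1) / 2.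
have qt : q < t by rewrite /t; lra.
have t1 : t < 1 by rewrite /t; lra.
have tt : t < t' by rewrite /t' /t; lra.
have t'1 : t' < 1 by rewrite /t' /t; lra.
have t0 : 0 <= t by rewrite (le_trans q0) ?ltW.
have t'0 : 0 <= t' by rewrite (le_trans t0) ?ltW.
pose E N := \sum_(i < N) \sum_(j < N | (N <= i + j)%N) (a i * z ^+ i) * (b j * z ^+ j).
have EN N : series (fun n => a n * z ^+ n) N * series (fun n => b n * z ^+ n) N
    - E N = series (fun n => pconv a b n * z ^+ n) N.
  rewrite !series_ordE; apply/esym.
  transitivity (\sum_(n < N) \sum_(k < n.+1)
      (a k * z ^+ k) * (b (n - k)%N * z ^+ (n - k))).
    apply: eq_bigr => n _; rewrite mulr_suml; apply: eq_bigr => k _.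
    have -> : z ^+ n = z ^+ k * z ^+ (n - k) by rewrite -exprD subnKC // -ltnS.
    by ring.
  rewrite (sum_triangle (fun i j => a i * z ^+ i * (b j * z ^+ j))).
  apply/eqP; rewrite -subr_eq opprK /E -big_split mulr_suml; apply/eqP.
  apply: eq_bigr => i _ /=; rewrite mulr_sumr [RHS](bigID (fun j : 'I_N => (i + j < N)%N)) /=.
  by congr (_ + _); apply: eq_bigl => j; rewrite -leqNgt.
have E0 : E @ \oo --> (0 : R[i]^o).
  pose c := (t - q)^-1 * (t' - t)^-1 * (M * P).
  apply: (@cvgC_squeeze _ _ _ (geometric c t')); last by apply: cvg_geometric; rewrite ger0_norm.
  move=> N; rewrite subr0 /=.
  apply: (@le_trans _ _ (\sum_(i < N) \sum_(j < N) M * P * q ^+ N)).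
    apply: le_trans (normc_sum _ _ _) _; apply: ler_sum => i _.
    apply: le_trans (normc_sum _ _ _) _; rewrite big_mkcond; apply: ler_sum => j _.
    case: leqP => ij; last by rewrite !mulr_ge0 ?exprn_ge0.
    rewrite normcM; apply: le_trans (ler_pM (normc_ge0 _) (normc_ge0 _)
      (coef_bound_term z i HM r0) (coef_bound_term z j HP r0)) _.
    rewrite -/q mulrACA -exprD ler_wpM2l ?mulr_ge0 //.
    by rewrite -(subnKC ij) exprD ler_piMr ?exprn_ge0 // exprn_ile1 // ltW.
  rewrite !sumr_const !card_ord -[leLHS]mulr_natr -[X in X * N%:R <= _]mulr_natr.
  have -> : M * P * q ^+ N * N%:R * N%:R = M * P * (N%:R * (N%:R * q ^+ N)) by ring.
  have -> : c * t' ^+ N = M * P * ((t - q)^-1 * ((t' - t)^-1 * t' ^+ N)) by rewrite /c; ring.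
  rewrite ler_wpM2l ?mulr_ge0 //.
  apply: (@le_trans _ _ (N%:R * ((t - q)^-1 * t ^+ N))).
    by rewrite ler_wpM2l // (expn_mul_geometric N q0 qt t1).
  rewrite mulrCA ler_wpM2l ?invr_ge0 ?subr_ge0 ?(ltW qt) //.
  exact: (expn_mul_geometric N t0 tt t'1).
have := cvgCD (cvgCM (psum_cvg ar zr) (psum_cvg br zr)) (cvgCM (cvgC_cst (-1)) E0).
by rewrite mulr0 addr0; apply: cvgC_ext => N; rewrite mulN1r EN.
Qed.

End CauchyProduct.

(** * The exponential *)

Section Exponential.
Variable R : realType.
Implicit Types (a b : nat -> R[i]) (z w : R[i]) (r s : R).

Definition entire_coef a := forall r, 0 < r -> coef_bounded a r.

Lemma entire_cder a z : entire_coef a -> cder (psum a) z (psum (pdiff a) z).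
Proof.
move=> ea; have z1 : 0 < normc z + 1 by rewrite ltr_wpDl ?normc_ge0.
by apply: (psum_cder (ea _ z1)); rewrite ltrDl.
Qed.

Lemma entire_shift a : entire_coef a -> entire_coef (fun n => a n.+1).
Proof. by move=> ea r r0; apply: coef_bounded_shift (ea _ r0). Qed.

Lemma entire_psum_shift a z : entire_coef a ->
  psum a z = a 0%N + z * psum (fun n => a n.+1) z.
Proof.
move=> ea; have z1 : 0 < normc z + 1 by rewrite ltr_wpDl ?normc_ge0.
by apply: (psum_shift (ea _ z1) (entire_shift ea z1)); rewrite ltrDl.
Qed.

Lemma entireD a b : entire_coef a -> entire_coef b -> entire_coef (fun n => a n + b n).
Proof.
move=> ea eb r r0; have [M HM] := ea r r0; have [P HP] := eb r r0.
exists (M + P) => n; apply: le_trans (lerD (HM n) (HP n)).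
by rewrite -mulrDl ler_wpM2r ?exprn_ge0 ?(ltW r0) // normcD.
Qed.

Lemma entireZ c a : entire_coef a -> entire_coef (fun n => c * a n).
Proof.
move=> ea r r0; have [M HM] := ea r r0; exists (normc c * M) => n.
by rewrite normcM -mulrA ler_wpM2l ?normc_ge0.
Qed.

Lemma entire_psumD a b z : entire_coef a -> entire_coef b ->
  psum (fun n => a n + b n) z = psum a z + psum b z.
Proof.
move=> ea eb; have z1 : 0 < normc z + 1 by rewrite ltr_wpDl ?normc_ge0.
by apply: (psumD (ea _ z1) (eb _ z1)); rewrite ltrDl.
Qed.

Lemma entire_psumZ c a z : entire_coef a -> psum (fun n => c * a n) z = c * psum a z.
Proof.
move=> ea; have z1 : 0 < normc z + 1 by rewrite ltr_wpDl ?normc_ge0.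
by apply: (psumZ _ (ea _ z1)); rewrite ltrDl.
Qed.

Definition exp_coef n : R[i] := (n`!%:R)^-1.

Lemma exp_coef_entire : entire_coef exp_coef.
Proof.
move=> r r0; exists (expR r) => n; rewrite normcV normc_nat mulrC.
case: n => [|n]; last first.
  by apply: le_trans (expR_ge1Dxn n (ltW r0)); rewrite lerDr.
by rewrite expr0 mul1r invr1 ltW // expR_gt1.
Qed.

Lemma pdiff_exp_coef : pdiff exp_coef = exp_coef.
Proof.
apply/funext => n; rewrite /pdiff /exp_coef factS natrM invfM mulrC mulrA divff ?mul1r //.
Qed.

Let E := psum exp_coef.

Let E_cder z : cder E z (E z).
Proof. by have := entire_cder z exp_coef_entire; rewrite pdiff_exp_coef. Qed.

Let E0 : E 0 = 1.
Proof. by rewrite /E psum0 /exp_coef invr1. Qed.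

(** The function u |-> f u * f (z + w - u) has derivative zero. *)
Lemma exp_law (f : R[i] -> R[i]) : (forall z, cder f z (f z)) -> f 0 = 1 ->
  {morph f : z w / z + w >-> z * w}.
Proof.
move=> f' f0 z w; pose g u := f u * f (z + w - u).
have g' u : cder g u 0.
  apply: (@cder_eq _ _ _ (f u * f (z + w - u) + f u * (f (z + w - u) * (0 - 1)))).
    apply: cderM => //; apply: (cder_comp (f := f)) => //.
    by apply: cderB; [exact: cder_cst|exact: cder_id].
  by rewrite sub0r mulrN mulr1 mulrN subrr.
have := cder0_const g' 0 z; rewrite /g f0 mul1r subr0 => ->.
by rewrite addrAC subrr add0r.
Qed.

Let ED z w : E (z + w) = E z * E w.
Proof. exact: exp_law E_cder E0 z w. Qed.

Let E_real (x : R) : E x%:C = (expR x)%:C.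
Proof.
apply: psum_eq; apply: (@cvgC_ReIm _ _ (expR x) 0).
  rewrite [X in X @ \oo --> _](_ : _ = series (exp_coeff x)).
    exact: is_cvg_series_exp_coeff.
  apply/funext => n; rewrite !series_ordE (raddf_sum (@complex.Re R)).
  apply: eq_bigr => i _; rewrite /exp_coef /exp_coeff /= mulrC.
  by rewrite -rmorphXn -(rmorph_nat (real_complex R)) -fmorphV -rmorphM.
rewrite [X in X @ \oo --> _](_ : _ = fun=> 0); first exact: cvg_cst.
apply/funext => n; rewrite !series_ordE (raddf_sum (@complex.Im R)).
apply: big1 => i _; rewrite /exp_coef /exp_coeff /=.
by rewrite -rmorphXn -(rmorph_nat (real_complex R)) -fmorphV -rmorphM.
Qed.

Lemma exp_i n : ('i%C : R[i]) ^+ n =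
  ((~~ odd n)%:R * (-1) ^+ n./2) +i* ((odd n)%:R * (-1) ^+ n.-1./2).
Proof.
have i2 m : ('i%C : R[i]) ^+ m.*2 = ((-1) ^+ m)%:C.
  by rewrite -mul2n exprM sqr_i rmorphXn rmorphN1.
rewrite -[n in LHS]odd_double_half; case: (boolP (odd n)) => on.
  rewrite add1n exprS i2 mul0r mul1r.
  have -> : n.-1./2 = n./2 by rewrite -[n in LHS]odd_double_half on add1n /= doubleK.
  by simpc.
by rewrite add0n i2 mul0r mul1r.
Qed.

Let E_imag (y : R) : E ('i * y%:C) = cos y +i* sin y.
Proof.
have term i : exp_coef i * ('i * y%:C) ^+ i = cos_coeff y i +i* sin_coeff y i.
  rewrite exprMn exp_i /exp_coef -rmorphXn -(rmorph_nat (real_complex R)) -fmorphV.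
  rewrite /cos_coeff /sin_coeff /=; simpc.
  by congr (_ +i* _); rewrite [LHS]mulrC.
apply: psum_eq; apply: cvgC_ReIm.
  rewrite [X in X @ \oo --> _](_ : _ = series (cos_coeff y)).
    by rewrite unlock; exact: is_cvg_series_cos_coeff.
  apply/funext => n; rewrite !series_ordE (raddf_sum (@complex.Re R)).
  by apply: eq_bigr => i _; rewrite term.
rewrite [X in X @ \oo --> _](_ : _ = series (sin_coeff y)).
  by rewrite unlock; exact: is_cvg_series_sin_coeff.
apply/funext => n; rewrite !series_ordE (raddf_sum (@complex.Im R)).
by apply: eq_bigr => i _; rewrite term.
Qed.

(** The addition law reduces this to real and to imaginary arguments, where the
    series are those defining expR, cos and sin. *)
Lemma cexp_psum z : cexp z = psum exp_coef z.
Proof. by rewrite [in RHS](complexE z) -/E ED E_real E_imag. Qed.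

Lemma cexpD z w : cexp (z + w) = cexp z * cexp w.
Proof. by rewrite !cexp_psum -/E ED. Qed.

Lemma cexp0 : cexp 0 = 1 :> R[i].
Proof. by rewrite cexp_psum -/E E0. Qed.

Lemma cexpNK z : cexp (- z) * cexp z = 1.
Proof. by rewrite -cexpD addNr cexp0. Qed.

Lemma cexp_neq0 z : cexp z != 0.
Proof. by apply: contra_eq_neq (cexpNK z) => ->; rewrite mulr0 eq_sym oner_eq0. Qed.

Lemma cexpN z : cexp (- z) = (cexp z)^-1.
Proof. by apply: (mulIf (cexp_neq0 z)); rewrite cexpNK mulVf ?cexp_neq0. Qed.

Lemma cexpB z w : cexp (z - w) = cexp z / cexp w.
Proof. by rewrite cexpD cexpN. Qed.

Lemma cexp_cder z : cder (@cexp R) z (cexp z).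
Proof. by rewrite cexp_psum; apply: cder_ext (E_cder z) => x; rewrite cexp_psum. Qed.

(** (e^z - 1) / z, continued analytically to the origin. *)
Definition cexp_quot z : R[i] := psum (fun n => exp_coef n.+1) z.

Lemma cexp_quotE z : cexp z = 1 + z * cexp_quot z.
Proof.
by rewrite cexp_psum (entire_psum_shift _ exp_coef_entire) /exp_coef invr1.
Qed.

Lemma cexp_quot0 : cexp_quot 0 = 1.
Proof. by rewrite /cexp_quot psum0 /exp_coef invr1. Qed.

Lemma cexp_quot_cder z : exists d, cder cexp_quot z d.
Proof. by eexists; apply: entire_cder (entire_shift exp_coef_entire). Qed.

Lemma normc_cexp z : normc (cexp z) = expR (complex.Re z).
Proof.
rewrite /cexp normcM normc_real ger0_norm ?expR_ge0 //= cos2Dsin2 sqrtr1 mulr1 //.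
Qed.

Definition twopi_i : R[i] := 0 +i* (pi *+ 2).

Lemma cexp_twopi_i : cexp twopi_i = 1.
Proof. by rewrite /cexp /= expR0 cos2pi sin2pi mul1r. Qed.

Lemma cexpMz z (m : int) : cexp z = 1 -> cexp (z *~ m) = 1.
Proof.
move=> z1; have nat_case n : cexp (z *+ n) = 1.
  by elim: n => [|n IH]; rewrite ?mulr0n ?cexp0 // mulrS cexpD z1 IH mulr1.
by case: m => n; rewrite ?NegzE ?mulrNz ?cexpN -pmulrn nat_case ?invr1.
Qed.

(** Subtracting a multiple of 2 pi i brings the imaginary part into [0, 2 pi[,
    where the cosine is 1 only at 0. *)
Lemma cexp_eq1P z : cexp z = 1 <-> exists m : int, z = twopi_i *~ m.
Proof.
split=> [z1|[m ->]]; last exact: cexpMz cexp_twopi_i.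
have pi2 : 0 < pi *+ 2 :> R by rewrite pmulrn_lgt0 ?pi_gt0.
pose m := Num.floor (complex.Im z / (pi *+ 2)); exists m.
pose w := z - twopi_i *~ m.
have w1 : cexp w = 1 by rewrite cexpB z1 cexpMz ?cexp_twopi_i ?divr1.
have Rew : complex.Re w = 0.
  by apply: expR_inj; rewrite -normc_cexp w1 normc1 expR0.
have Imm : complex.Im (twopi_i *~ m) = pi *+ 2 *~ m by rewrite (raddfMz (@complex.Im R)).
have Imw : 0 <= complex.Im w < pi *+ 2.
  rewrite /w (raddfB (@complex.Im R)) /= Imm -mulrzr subr_ge0 ltrBlDr.
  have /andP[m1 m2] := floor_itv (complex.Im z / (pi *+ 2)).
  rewrite mulrC -ler_pdivlMr // m1 /=.
  move: m2; rewrite intrD ltr_pdivrMr // -/m => m2; rewrite mulrC; apply: lt_le_trans m2 _.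
  by rewrite mulrDl mul1r addrC mulrC.
have cw : cos (complex.Im w) = 1.
  by have := congr1 (@complex.Re R) w1; rewrite /cexp Rew expR0 mul1r.
suff I0 : complex.Im w = 0.
  by apply/eqP; rewrite -subr_eq0 -/w eq_complex Rew I0 !eqxx.
case/andP: Imw => w0 w2; have [wpi|wpi] := leP (complex.Im w) pi.
  by apply: (@cos_inj R); rewrite ?in_itv /= ?w0 ?lexx ?pi_ge0 // cw cos0.
have : pi *+ 2 - complex.Im w = 0.
  apply: (@cos_inj R); rewrite ?in_itv /= ?lexx ?pi_ge0 ?subr_ge0 ?(ltW w2) //=.
    by rewrite mulr2n lerBlDl lerD2r ltW.
  by rewrite addrC cosD2pi cosN cw cos0.
by move/eqP; rewrite subr_eq0 => /eqP e; rewrite e ltxx in w2.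
Qed.

End Exponential.

(** * The logarithm near 1 *)

Section Logarithm.
Variable R : realType.
Implicit Types (z w : R[i]).

Definition log_coef n : R[i] := if n is m.+1 then (-1) ^+ m / m.+1%:R else 0.

(** Only meant for |z - 1| < 1, where it is the principal logarithm. *)
Definition clog z : R[i] := psum log_coef (z - 1).

(** clog z / (z - 1), continued analytically to z = 1. *)
Definition clog_quot z : R[i] := psum (fun n => log_coef n.+1) (z - 1).

Lemma normc_sign n : normc ((-1 : R[i]) ^+ n) = 1.
Proof. by rewrite normcX normcN normc1 expr1n. Qed.

Lemma log_coef_bounded : coef_bounded log_coef 1.
Proof.
exists 1 => -[|n]; rewrite expr1n mulr1; first by rewrite normc0.
rewrite normcM normc_sign mul1r normcV normc_nat.
by rewrite invf_le1 ?ler1n ?ltr0n.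
Qed.

Lemma pdiff_log_coef n : pdiff log_coef n = (-1) ^+ n.
Proof. by rewrite /pdiff /log_coef -mulrA mulVf ?mulr1 // pnatr_eq0. Qed.

(** The shift of the series is its opposite, so f = 1 - w f. *)
Lemma geometric_psum w : normc w < 1 -> psum (fun n => (-1) ^+ n) w = (1 + w)^-1.
Proof.
move=> w1; set c := fun n => _.
have bc : coef_bounded c 1 by exists 1 => n; rewrite /c normc_sign expr1n mulr1.
have bc' : coef_bounded (fun n => c n.+1) 1 by apply: coef_bounded_shift.
have := psum_shift bc bc' w1.
have -> : (fun n => c n.+1) = (fun n => -1 * c n) by apply/funext => n; rewrite /c exprS.
rewrite (psumZ (-1) bc w1) {2}/c expr0 mulN1r mulrN => e.
have {}e : psum c w * (1 + w) = 1 by rewrite mulrDr mulr1 {1}e mulrC subrK.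
have nz : 1 + w != 0 by apply: contra_eq_neq e => ->; rewrite mulr0 eq_sym oner_eq0.
by apply: (mulIf nz); rewrite e mulVf.
Qed.

Lemma clog1 : clog 1 = 0.
Proof. by rewrite /clog subrr psum0. Qed.

Lemma clog_cder z : normc (z - 1) < 1 -> cder clog z z^-1.
Proof.
move=> z1.
have := psum_cder log_coef_bounded z1.
have -> : pdiff log_coef = (fun n => (-1) ^+ n) by apply/funext => n; exact: pdiff_log_coef.
rewrite geometric_psum // [1 + _]addrC subrK => d.
apply: (@cder_eq _ _ _ (z^-1 * (1 - 0))); last by rewrite subr0 mulr1.
apply: (cder_comp (f := psum log_coef)) => //.
by apply: cderB; [exact: cder_id|exact: cder_cst].
Qed.

Lemma normc_lt1_neq0 z : normc (z - 1) < 1 -> z != 0.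
Proof. by apply: contraTneq => ->; rewrite sub0r normcN normc1 ltxx. Qed.

(** The function z |-> z * cexp (- clog z) has derivative zero on the disc and
    takes the value 1 at 1. *)
Lemma clogK z : normc (z - 1) < 1 -> cexp (clog z) = z.
Proof.
move=> z1; pose f u := u * cexp (- clog u).
have f' u : normc (u - 1) < 1 -> cder f u 0.
  move=> u1; have u0 := normc_lt1_neq0 u1.
  apply: (@cder_eq _ _ _ (1 * cexp (- clog u) + u * (cexp (- clog u) * (- u^-1)))).
    apply: cderM; first exact: cder_id.
    apply: (cder_comp (f := @cexp R)); last exact: cexp_cder.
    by apply: cderN; exact: clog_cder.
  by rewrite !mulrN [u * _]mulrCA divff // mulr1 mul1r subrr.
have : f 1 = f z.
  apply: cder0_segment => t /andP[t0 t1]; apply: f'.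
  rewrite addrC addKr normcM normc_real ger0_norm //.
  by apply: le_lt_trans z1; rewrite ler_piMl ?normc_ge0.
rewrite /f clog1 oppr0 cexp0 mulr1 cexpN => /esym e.
by apply/esym/(mulIf (invr_neq0 (cexp_neq0 (clog z)))); rewrite e divff ?cexp_neq0.
Qed.

Lemma clog_quotE z : normc (z - 1) < 1 -> clog z = (z - 1) * clog_quot z.
Proof.
move=> z1; rewrite /clog (psum_shift log_coef_bounded _ z1) ?add0r //.
exact: coef_bounded_shift log_coef_bounded.
Qed.

Lemma clog_quot_cder z : normc (z - 1) < 1 -> exists d, cder clog_quot z d.
Proof.
move=> z1; have b : coef_bounded (fun n => log_coef n.+1) 1.
  exact: coef_bounded_shift log_coef_bounded.
eexists; apply: (cder_comp (f := psum (fun n => log_coef n.+1))).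
  by apply: cderB; [exact: cder_id|exact: cder_cst].
exact: psum_cder b z1.
Qed.

Lemma cexp_near0 (e : R) : 0 < e ->
  exists2 r : R, 0 < r & forall w, normc w < r -> normc (cexp w - 1) < e.
Proof.
move=> e0; have [r r0 H] := cder_continuous (cexp_cder 0) e0.
by exists r => // w wr; have := H w; rewrite subr0 cexp0; apply.
Qed.

(** The function w |-> clog (cexp w) - w has derivative zero near 0. *)
Lemma cexpK_near0 : exists2 r : R, 0 < r & forall w, normc w < r ->
  normc (cexp w - 1) < 1 /\ clog (cexp w) = w.
Proof.
have [r r0 H] := cexp_near0 ltr01; exists r => // w wr; split; first exact: H.
pose f u := clog (cexp u) - u.
have : f 0 = f w.
  apply: cder0_segment => t /andP[t0 t1]; rewrite add0r subr0.
  set u := _ * w; have ur : normc u < r.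
    rewrite /u normcM normc_real ger0_norm //.
    by apply: le_lt_trans wr; rewrite ler_piMl ?normc_ge0.
  apply: (@cder_eq _ _ _ ((cexp u)^-1 * cexp u - 1)); last first.
    by rewrite mulVf ?cexp_neq0 ?subrr.
  apply: cderB; last exact: cder_id.
  apply: (cder_comp (f := clog)); first exact: cexp_cder.
  by apply: clog_cder; exact: H.
by rewrite /f cexp0 clog1 subr0 => /esym/eqP; rewrite subr_eq0 => /eqP.
Qed.

Lemma clog_near1 (e : R) : 0 < e ->
  exists2 r : R, 0 < r & forall z, normc (z - 1) < r -> normc (clog z) < e.
Proof.
move=> e0; have z1 : normc (1 - 1 : R[i]) < 1 by rewrite subrr normc0.
have [r r0 H] := cder_continuous (clog_cder z1) e0.
by exists r => // z zr; have := H z zr; rewrite clog1 subr0.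
Qed.

End Logarithm.

(** * Linear differential equations with entire coefficients *)

Section LinearODE.
Variable (R : realType) (N : nat).
Implicit Types (H G : nat -> 'M[R[i]]_N) (A B : 'M[R[i]]_N) (z w : R[i]).

Definition mnorm A : R := \sum_i \sum_j normc (A i j).

Lemma mnorm_ge0 A : 0 <= mnorm A.
Proof. by apply: sumr_ge0 => i _; apply: sumr_ge0 => j _; exact: normc_ge0. Qed.

Lemma normc_le_mnorm A i j : normc (A i j) <= mnorm A.
Proof.
rewrite /mnorm (bigD1 i) //= (bigD1 j) //= -addrA lerDl addr_ge0 //.
  by apply: sumr_ge0 => k _; exact: normc_ge0.
by apply: sumr_ge0 => k _; apply: sumr_ge0 => l _; exact: normc_ge0.
Qed.

Lemma mnormZ c A : mnorm (c *: A) = normc c * mnorm A.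
Proof.
rewrite /mnorm mulr_sumr; apply: eq_bigr => i _; rewrite mulr_sumr.
by apply: eq_bigr => j _; rewrite mxE normcM.
Qed.

Lemma mnorm_sum n (F : 'I_n -> 'M[R[i]]_N) : mnorm (\sum_i F i) <= \sum_i mnorm (F i).
Proof.
rewrite /mnorm [leRHS]exchange_big; apply: ler_sum => i _; rewrite [leRHS]exchange_big.
by apply: ler_sum => j _; rewrite summxE; exact: normc_sum.
Qed.

Lemma mnormM A B : mnorm (A *m B) <= mnorm A * mnorm B.
Proof.
rewrite /mnorm mulr_suml; apply: ler_sum => i _; rewrite mulr_suml.
apply: (@le_trans _ _ (\sum_j \sum_k normc (A i k) * normc (B k j))).
  apply: ler_sum => j _; rewrite mxE; apply: le_trans (normc_sum _ _ _) _.
  by apply: ler_sum => k _; rewrite normcM.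
rewrite exchange_big; apply: ler_sum => k _ /=; rewrite -mulr_sumr.
rewrite ler_wpM2l ?normc_ge0 // [leRHS](bigD1 k) //= lerDl.
by apply: sumr_ge0 => l _; apply: sumr_ge0 => j _; exact: normc_ge0.
Qed.

Definition entire_mx H := forall i j, entire_coef (fun n => H n i j).

Definition mpsum H z : 'M[R[i]]_N := \matrix_(i, j) psum (fun n => H n i j) z.

Lemma entire_mxP H : entire_mx H <->
  forall r : R, 0 < r -> exists M, forall n, mnorm (H n) * r ^+ n <= M.
Proof.
split=> [eH r r0|eH i j r r0]; last first.
  have [M HM] := eH r r0; exists M => n; apply: le_trans (HM n).
  by rewrite ler_wpM2r ?exprn_ge0 ?(ltW r0) ?normc_le_mnorm.
have /choice[M HM] : forall ij : 'I_N * 'I_N, exists M, forall n,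
    normc (H n ij.1 ij.2) * r ^+ n <= M by move=> ij; exact: eH.
exists (\sum_i \sum_j M (i, j)) => n; rewrite /mnorm mulr_suml.
apply: ler_sum => i _; rewrite mulr_suml; apply: ler_sum => j _.
exact: (HM (i, j)).
Qed.

(** The coefficients of the solution of G' = H G with G(0) = 1, listed in
    decreasing order of the exponent: the recursion needs all previous ones. *)
Fixpoint ode_prefix H n : seq 'M[R[i]]_N :=
  if n is m.+1 then
    (m.+1%:R^-1 *: \sum_(k < m.+1) H k *m nth 0 (ode_prefix H m) k) :: ode_prefix H m
  else [:: 1%:M].

Definition ode_coef H n := head 0 (ode_prefix H n).

Lemma nth_ode_prefix H n k : (k <= n)%N -> nth 0 (ode_prefix H n) k = ode_coef H (n - k).
Proof.
by elim: n k => [|n IH] [|k] //= kn; rewrite subSS IH.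
Qed.

Lemma ode_coef0 H : ode_coef H 0 = 1%:M. Proof. by []. Qed.

Lemma ode_coefS H n : n.+1%:R *: ode_coef H n.+1 =
  \sum_(k < n.+1) H k *m ode_coef H (n - k).
Proof.
rewrite /ode_coef /= scalerA divff ?pnatr_eq0 // scale1r.
by apply: eq_bigr => k _; rewrite nth_ode_prefix // -ltnS.
Qed.

(** Once n exceeds r * sum |H_k| r^k, the recursion no longer increases
    |G_n| r^n. *)
Lemma ode_coef_entire H : entire_mx H -> entire_mx (ode_coef H).
Proof.
move=> /entire_mxP eH; apply/entire_mxP => r r0.
(* Twice the radius makes sum |H_k| r^k converge. *)
have r20 : 0 < r * 2 by rewrite mulr_gt0.
have [M HM] := eH _ r20.
have M0 : 0 <= M by rewrite (le_trans _ (HM 0%N)) // mulr_ge0 ?mnorm_ge0 ?exprn_ge0 ?ltW.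
pose S := M * 2.
have HS n : \sum_(k < n) mnorm (H k) * r ^+ k <= S.
  apply: (@le_trans _ _ (\sum_(k < n) M * (2^-1) ^+ k)).
    apply: ler_sum => k _; rewrite exprVn ler_pdivlMr ?exprn_gt0 //.
    by rewrite -mulrA -exprMn.
  pose h : R := 2^-1.
  have h01 : 0 <= h < 1 by rewrite /h invr_ge0 ler0n invf_lt1 ?ltr1n.
  apply: le_trans (geometric_sum_le n M0 h01) _.
  have -> : 1 - h = h by rewrite /h; lra.
  by rewrite /S /h invrK.
pose N0 := (Num.trunc (r * S)).+1.
have HN0 : r * S <= N0%:R.
  have rS : 0 <= r * S by rewrite mulr_ge0 ?(ltW r0) // mulr_ge0.
  by have := truncnS_gt (r * S); rewrite /N0 => /ltW.
pose g n := mnorm (ode_coef H n) * r ^+ n.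
have g0 n : 0 <= g n by rewrite mulr_ge0 ?mnorm_ge0 ?exprn_ge0 ?ltW.
(* A sum instead of the maximum of the first terms. *)
pose C := \sum_(m < N0.+1) g m.
exists C; elim/ltn_ind => n IH; rewrite -/(g n).
have [nN|Nn] := leqP n N0.
  rewrite /C (bigD1 (Ordinal (nN : (n < N0.+1)%N))) //= lerDl; exact: sumr_ge0.
case: n IH Nn => // n IH Nn.
have C0 : 0 <= C by exact: sumr_ge0.
have n0 : 0 < n.+1%:R :> R by rewrite ltr0n.
rewrite -(ler_pM2l n0).
have -> : n.+1%:R * g n.+1 = mnorm (n.+1%:R *: ode_coef H n.+1) * r ^+ n.+1.
  by rewrite mnormZ normc_nat mulrA.
rewrite ode_coefS.
apply: (@le_trans _ _ (r * (S * C))); last first.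
  rewrite mulrA ler_wpM2r // (le_trans HN0) // ler_nat ltnW //.
apply: (@le_trans _ _ (r * \sum_(k < n.+1) (mnorm (H k) * r ^+ k) * C)); last first.
  by rewrite ler_wpM2l ?(ltW r0) // -mulr_suml ler_wpM2r.
rewrite exprS mulrCA ler_wpM2l ?(ltW r0) //.
apply: le_trans (ler_wpM2r (exprn_ge0 _ (ltW r0)) (mnorm_sum _)) _.
rewrite mulr_suml; apply: ler_sum => k _.
apply: le_trans (ler_wpM2r (exprn_ge0 _ (ltW r0)) (mnormM _ _)) _.
have kn : (k <= n)%N by rewrite -ltnS.
have -> : r ^+ n = r ^+ k * r ^+ (n - k) by rewrite -exprD subnKC.
rewrite mulrACA ler_wpM2l ?mulr_ge0 ?mnorm_ge0 ?exprn_ge0 ?(ltW r0) //.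
by apply: IH; rewrite ltnS leq_subr.
Qed.

Lemma mpsum_ode_coef0 H : mpsum (ode_coef H) 0 = 1%:M.
Proof. by apply/matrixP => i j; rewrite mxE psum0 ode_coef0. Qed.

(** Differentiability entry by entry; the normed structure on matrices only
    enters at the end. *)
Definition mcder (F : R[i] -> 'M[R[i]]_N) z (D : 'M[R[i]]_N) :=
  forall i j, cder (fun x => F x i j) z (D i j).

(** The recursion says that the coefficients of the derivative are those of the
    Cauchy product. *)
Lemma mpsum_ode_cder H z : entire_mx H ->
  mcder (mpsum (ode_coef H)) z (mpsum H z *m mpsum (ode_coef H) z).
Proof.
move=> eH i j; have eG := ode_coef_entire eH.
apply: (@cder_ext _ (psum (fun n => ode_coef H n i j))) => [x|]; first by rewrite mxE.
apply: cder_eq (entire_cder z (eG i j)) _; apply: psum_eq.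
have z1 : 0 < normc z + 1 by rewrite ltr_wpDl ?normc_ge0.
have zz : normc z < normc z + 1 by rewrite ltrDl.
have cv l := psum_mul (eH i l _ z1) (eG l j _ z1) zz.
have sums m (u : 'I_m -> nat -> R[i]) (a : 'I_m -> R[i]) :
    (forall l, (u l : nat -> R[i]) @ \oo --> (a l : R[i]^o)) ->
    (fun n => \sum_l u l n) @ \oo --> (\sum_l a l : R[i]^o).
  elim: m u a => [|m IH] u a Hu.
    by rewrite big_ord0; apply: (cvgC_ext _ (cvgC_cst 0)) => n; rewrite big_ord0.
  rewrite big_ord_recr; apply: (cvgC_ext _ (cvgCD (IH _ _ (fun l => Hu _)) (Hu ord_max))) => n.
  by rewrite big_ord_recr.
have -> : (mpsum H z *m mpsum (ode_coef H) z) i j =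
    \sum_l psum (fun n => H n i l) z * psum (fun n => ode_coef H n l j) z.
  by rewrite mxE; apply: eq_bigr => l _; rewrite !mxE.
apply: (cvgC_ext _ (sums _ _ _ cv)) => n.
under eq_bigr do rewrite series_ordE.
rewrite series_ordE exchange_big; apply: eq_bigr => m _.
rewrite -mulr_suml; congr (_ * _).
have := congr1 (fun A : 'M[R[i]]_N => A i j) (ode_coefS H m).
rewrite mxE mulrC summxE /pdiff => ->.
rewrite /pconv exchange_big; apply: eq_bigr => k _.
by have -> // : (H k *m ode_coef H (m - k)) i j =
  \sum_l H k i l * ode_coef H (m - k) l j by rewrite mxE.
Qed.

End LinearODE.

(** * Coordinates *)

Section Coordinates.
Variables (R : realType) (g : vectType R[i]).
Local Notation N := (\dim {:g}).
Implicit Types (x y z : g) (f h : 'End(g)) (A B M Mf Mh : 'M[R[i]]_N).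

Lemma vb_decomp x : x = \sum_i cb i x *: vb i.
Proof. exact: coord_vbasis (memvf x). Qed.

Lemma cb_vb i j : cb i (vb j : g) = (i == j)%:R.
Proof. by rewrite /cb /vb coord_free ?(basis_free (vbasisP _)) // eq_sym. Qed.

Lemma cb_inj x y : (forall i, cb i x = cb i y) -> x = y.
Proof.
by move=> e; rewrite (vb_decomp x) (vb_decomp y); apply: eq_bigr => i _; rewrite e.
Qed.

Lemma cbD i x y : cb i (x + y) = cb i x + cb i y. Proof. exact: raddfD. Qed.
Lemma cbN i x : cb i (- x) = - cb i x. Proof. exact: raddfN. Qed.
Lemma cbB i x y : cb i (x - y) = cb i x - cb i y. Proof. exact: raddfB. Qed.
Lemma cbZ i c x : cb i (c *: x) = c * cb i x. Proof. exact: linearZ. Qed.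
Lemma cb_sum i (I : Type) (r : seq I) (P : pred I) (F : I -> g) :
  cb i (\sum_(k <- r | P k) F k) = \sum_(k <- r | P k) cb i (F k).
Proof. exact: raddf_sum. Qed.

Lemma sum_delta n (F : 'I_n -> R[i]) j : \sum_i (i == j)%:R * F i = F j.
Proof.
rewrite (bigD1 j) //= eqxx mul1r big1 ?addr0 // => i ne.
by rewrite (negbTE ne) mul0r.
Qed.

Lemma sum_deltar n (F : 'I_n -> R[i]) j : \sum_i F i * (j == i)%:R = F j.
Proof. by rewrite -[RHS]sum_delta; apply: eq_bigr => i _; rewrite mulrC eq_sym. Qed.

(** For a function that is only propositionally linear. *)
Lemma linfun_ext (f : g -> g) : linear f -> linfun f =1 f.
Proof.
move=> fl x; pose F : {linear g -> g} := HB.pack f (GRing.isLinear.Build _ _ _ _ _ fl).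
exact: (lfunE F).
Qed.

Lemma cb_lfun f x a : cb a (f x) = \sum_i cb i x * end_mx f i a.
Proof.
rewrite {1}(vb_decomp x) linear_sum cb_sum; apply: eq_bigr => i _.
by rewrite linearZ cbZ mxE.
Qed.

Lemma end_mx_comp f h : end_mx (f \o h)%VF = end_mx h *m end_mx f.
Proof.
apply/matrixP => i j; rewrite !mxE comp_lfunE cb_lfun.
by apply: eq_bigr => k _; rewrite [end_mx h _ _]mxE.
Qed.

Lemma end_mx1 : end_mx (\1%VF : 'End(g)) = 1%:M.
Proof. by apply/matrixP => i j; rewrite !mxE id_lfunE cb_vb eq_sym. Qed.

Lemma sum_scale_mxE n (c : 'I_n -> R[i]) (F : 'I_n -> 'M[R[i]]_N) i k :
  (\sum_a c a *: F a) i k = \sum_a c a * F a i k.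
Proof. by rewrite summxE; apply: eq_bigr => a _; exact: mxE. Qed.

Definition mx_end M : 'End(g) :=
  linfun (fun x => \sum_i \sum_j (cb i x * M i j) *: vb j).

Lemma mx_endE M x : mx_end M x = \sum_i \sum_j (cb i x * M i j) *: vb j.
Proof.
apply: (linfun_ext (f := fun x => _)) => c u v /=; rewrite scaler_sumr -big_split.
apply: eq_bigr => i _; rewrite scaler_sumr -big_split; apply: eq_bigr => j _.
by rewrite /= cbD cbZ scalerA -scalerDl mulrDl mulrA.
Qed.

Lemma mx_endK M : end_mx (mx_end M) = M.
Proof.
apply/matrixP => i j; rewrite mxE mx_endE cb_sum.
rewrite -[RHS](sum_delta (fun k => M k j) i); apply: eq_bigr => k _.
rewrite cb_sum -[RHS](sum_deltar (fun l => (k == i)%:R * M k l) j).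
by apply: eq_bigr => l _; rewrite cbZ !cb_vb.
Qed.

Lemma lker_end_mx f : end_mx f \in unitmx -> lker f = 0%VS.
Proof.
move=> uf; apply/eqP/lker0P => x y e; apply: cb_inj => i.
pose row x := \row_i cb i x : 'rV[R[i]]_N.
suff : row x = row y by move/rowP/(_ i); rewrite !mxE.
have rowf z : row (f z) = row z *m end_mx f.
  by apply/rowP => j; rewrite !mxE cb_lfun; apply: eq_bigr => k _; rewrite !mxE.
by apply: (can_inj (mulmxK uf)); rewrite -!rowf e.
Qed.

(** A right inverse matrix is enough, in finite dimension. *)
Lemma end_mx_inv f M : end_mx f *m M = 1%:M -> end_mx (f^-1)%VF = M.
Proof.
move=> fM; have uf : end_mx f \in unitmx by case/mulmx1_unit: fM.
have := congr1 (@end_mx R g) (lker0_compVf (introT eqP (lker_end_mx uf))).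
rewrite end_mx_comp end_mx1 => e.
by apply: (can_inj (mulKmx uf)); rewrite e fM.
Qed.

Lemma tensor_mapE f h A : tensor_map f h A = (end_mx f)^T *m A *m end_mx h.
Proof.
apply/matrixP => a b; rewrite /tensor_map summxE mxE.
under eq_bigr do rewrite summxE.
rewrite exchange_big; apply: eq_bigr => j _; rewrite mxE mulr_suml.
by apply: eq_bigr => i _; rewrite !mxE; ring.
Qed.

Lemma tensor_map_inv f h A Mf Mh : end_mx f *m Mf = 1%:M -> end_mx h *m Mh = 1%:M ->
  tensor_map f^-1%VF h^-1%VF A = Mf^T *m A *m Mh.
Proof.
move=> /end_mx_inv ef /end_mx_inv eh; rewrite tensor_mapE; move: ef eh.
by move: (end_mx f^-1%VF) (end_mx h^-1%VF) => P Q -> ->.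
Qed.

End Coordinates.

(** * Structure constants, derivations and automorphisms *)

Section LieAlgebra.
Variables (R : realType) (g : vectType R[i]) (br : g -> g -> g).
Hypothesis brL : is_lie_bracket br.
Local Notation N := (\dim {:g}).
Implicit Types (x y z : g) (A B M : 'M[R[i]]_N).

Let br_l y : linear (br^~ y). Proof. by case: brL. Qed.
Let br_r x : linear (br x). Proof. by case: brL. Qed.

Lemma brDl x y z : br (x + y) z = br x z + br y z.
Proof. by have := br_l z 1 x y; rewrite !scale1r. Qed.
Lemma brDr x y z : br z (x + y) = br z x + br z y.
Proof. by have := br_r z 1 x y; rewrite !scale1r. Qed.
Lemma br0l x : br 0 x = 0.
Proof. by apply: (addrI (br 0 x)); rewrite -brDl !addr0. Qed.
Lemma br0r x : br x 0 = 0.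
Proof. by apply: (addrI (br x 0)); rewrite -brDr !addr0. Qed.
Lemma brZl c x y : br (c *: x) y = c *: br x y.
Proof. by have := br_l y c x 0; rewrite br0l !addr0. Qed.
Lemma brZr c x y : br x (c *: y) = c *: br x y.
Proof. by have := br_r x c y 0; rewrite br0r !addr0. Qed.

Lemma br_suml n (F : 'I_n -> g) y : br (\sum_i F i) y = \sum_i br (F i) y.
Proof. by apply: (big_morph (br^~ y)) => [u v|]; rewrite ?brDl ?br0l. Qed.
Lemma br_sumr n (F : 'I_n -> g) y : br y (\sum_i F i) = \sum_i br y (F i).
Proof. by apply: (big_morph (br y)) => [u v|]; rewrite ?brDr ?br0r. Qed.

Lemma br_anti x y : br x y = - br y x.
Proof.
have := lie_alt brL (x + y); rewrite brDl !brDr !(lie_alt brL) add0r addr0 => /eqP.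
by rewrite addr_eq0 => /eqP.
Qed.

(** The Jacobi identity, saying that ad x is a derivation. *)
Lemma br_der x y z : br x (br y z) = br (br x y) z + br y (br x z).
Proof.
have := lie_jacobi brL x y z; rewrite (br_anti z x) (br_anti z (br x y)).
rewrite -[- br x z]scaleN1r brZr scaleN1r => /eqP.
by rewrite subr_eq0 subr_eq => /eqP.
Qed.

(** The structure constants as one bilinear form per coordinate of the result:
    the bracket in a tensor factor then becomes matrix multiplication. *)
Definition str_mx a : 'M[R[i]]_N := \matrix_(i, k) cb a (br (vb i) (vb k)).

Lemma cb_br x y a : cb a (br x y) = \sum_i \sum_k cb i x * cb k y * str_mx a i k.
Proof.
rewrite {1}(vb_decomp x) br_suml cb_sum; apply: eq_bigr => i _.
rewrite brZl cbZ {1}(vb_decomp y) br_sumr cb_sum mulr_sumr; apply: eq_bigr => k _.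
by rewrite brZr cbZ mulrA mxE.
Qed.

Definition ad_mx x : 'M[R[i]]_N := end_mx (linfun (br x)).

Lemma ad_mxE x i j : ad_mx x i j = cb j (br x (vb i)).
Proof. by rewrite mxE (linfun_ext (br_r x)). Qed.

Lemma cb_br_ad x y a : cb a (br x y) = \sum_i cb i y * ad_mx x i a.
Proof. by rewrite -cb_lfun (linfun_ext (br_r x)). Qed.

Lemma ad_mxD x y : ad_mx (x + y) = ad_mx x + ad_mx y.
Proof. by apply/matrixP => i j; rewrite [RHS]mxE !ad_mxE brDl cbD. Qed.

Lemma ad_mxZ c x : ad_mx (c *: x) = c *: ad_mx x.
Proof. by apply/matrixP => i j; rewrite [RHS]mxE !ad_mxE brZl cbZ. Qed.

Lemma ad_mx_sum n (F : 'I_n -> g) : ad_mx (\sum_i F i) = \sum_i ad_mx (F i).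
Proof.
apply: (big_morph ad_mx) => [x y|]; first exact: ad_mxD.
by rewrite -(scale0r (0 : g)) ad_mxZ scale0r.
Qed.

Lemma ad_mx_br x y : ad_mx (br x y) = ad_mx y *m ad_mx x - ad_mx x *m ad_mx y.
Proof.
have comp u v i j : (ad_mx v *m ad_mx u) i j = cb j (br u (br v (vb i))).
  by rewrite mxE cb_br_ad; apply: eq_bigr => k _; rewrite [ad_mx v _ _]ad_mxE.
apply/matrixP => i j; rewrite ad_mxE.
have -> : (ad_mx y *m ad_mx x - ad_mx x *m ad_mx y) i j =
  (ad_mx y *m ad_mx x) i j - (ad_mx x *m ad_mx y) i j by rewrite mxE [X in _ + X]mxE.
by rewrite !comp -cbB [br x (br y _)]br_der addrK.
Qed.

(** The derivation property of ad x, in coordinates. *)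
Lemma ad_mx_der x b : \sum_a ad_mx x a b *: str_mx a =
  ad_mx x *m str_mx b + str_mx b *m (ad_mx x)^T.
Proof.
apply/matrixP => i k; rewrite sum_scale_mxE.
transitivity (cb b (br x (br (vb i) (vb k)))).
  by rewrite cb_br_ad; apply: eq_bigr => a _; rewrite mulrC [str_mx _ _ _]mxE.
rewrite br_der cbD [RHS]mxE; congr (_ + _); rewrite [RHS]mxE.
  rewrite cb_br; apply: eq_bigr => p _.
  rewrite -[RHS](sum_deltar (fun q => _ * str_mx b p q) k).
  by apply: eq_bigr => q _; rewrite cb_vb ad_mxE [q == k]eq_sym; ring.
rewrite cb_br exchange_big; apply: eq_bigr => q _.
rewrite -[RHS](sum_deltar (fun p => str_mx b p q * _) i).
by apply: eq_bigr => p _; rewrite cb_vb [_^T _ _]mxE ad_mxE [p == i]eq_sym; ring.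
Qed.

(** Multiplicativity of the endomorphism with matrix M, in coordinates. *)
Definition aut_mx M := forall a, \sum_m M m a *: str_mx m = M *m str_mx a *m M^T.

Lemma aut_mx_lie_automorphism (f : 'End(g)) : end_mx f \in unitmx ->
  aut_mx (end_mx f) -> lie_automorphism br f.
Proof.
move=> uf af; split; first exact: lker_end_mx.
move=> x y; apply: cb_inj => a; rewrite cb_lfun cb_br.
under eq_bigr do rewrite cb_br mulr_suml.
rewrite exchange_big.
transitivity (\sum_i \sum_k cb i x * cb k y * (\sum_m end_mx f m a *: str_mx m) i k).
  apply: eq_bigr => i _; under eq_bigr do rewrite mulr_suml.
  rewrite exchange_big; apply: eq_bigr => k _; rewrite sum_scale_mxE mulr_sumr.
  by apply: eq_bigr => m _; ring.
rewrite af.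
transitivity (\sum_i \sum_k \sum_q \sum_p
   (cb i x * end_mx f i p) * (cb k y * end_mx f k q) * str_mx a p q).
  apply: eq_bigr => i _; apply: eq_bigr => k _; rewrite mxE mulr_sumr.
  apply: eq_bigr => q _; rewrite [(_ *m _) _ _]mxE [_^T _ _]mxE mulr_suml mulr_sumr.
  by apply: eq_bigr => p _; ring.
under eq_bigr do rewrite exchange_big.
under eq_bigr => i _ do under eq_bigr => q _ do rewrite exchange_big.
rewrite exchange_big; under eq_bigr do rewrite exchange_big.
rewrite exchange_big; apply: eq_bigr => p _; apply: eq_bigr => q _.
rewrite !cb_lfun mulr_suml mulr_suml; apply: eq_bigr => i _.
rewrite mulr_sumr mulr_suml; apply: eq_bigr => k _; by [].
Qed.

Lemma aut_mx_inv M M' : M *m M' = 1%:M -> aut_mx M -> aut_mx M'.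
Proof.
move=> MM' aM b.
have M'M : M' *m M = 1%:M by exact: mulmx1C.
have e : M *m (\sum_a M' a b *: str_mx a) *m M^T = str_mx b.
  rewrite mulmx_sumr mulmx_suml.
  under eq_bigr => a _ do rewrite -scalemxAr -scalemxAl -aM scaler_sumr.
  rewrite exchange_big /=.
  under eq_bigr => m _ do under eq_bigr => a _ do rewrite scalerA mulrC.
  transitivity (\sum_m (M *m M') m b *: str_mx m).
    by apply: eq_bigr => m _; rewrite -scaler_suml [(_ *m _) _ _]mxE.
  rewrite MM' (bigD1 b) //= mxE eqxx scale1r big1 ?addr0 // => m ne.
  by rewrite mxE (negbTE ne) scale0r.
rewrite -[in RHS]e !mulmxA M'M mul1mx -mulmxA -trmx_mul.
by rewrite (M'M) trmx1 mulmx1.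
Qed.

End LieAlgebra.

(** * The Yang-Baxter expression in coordinates *)

Section TensorBrackets.
Variables (R : realType) (g : vectType R[i]) (br : g -> g -> g).
Local Notation N := (\dim {:g}).
Implicit Types (A B M : 'M[R[i]]_N).
Local Notation S := (str_mx br).

Lemma tensor3_sumE (F : 'I_N -> 'I_N -> 'I_N -> 'I_N -> tensor3 g) t :
  (\sum_i \sum_j \sum_k \sum_l F i j k l) t = \sum_i \sum_j \sum_k \sum_l F i j k l t.
Proof.
rewrite sum_ffunE; apply: eq_bigr => i _; rewrite sum_ffunE; apply: eq_bigr => j _.
by rewrite sum_ffunE; apply: eq_bigr => k _; rewrite sum_ffunE.
Qed.

Lemma br12_13E A B a b c : br12_13 br A B (a, b, c) = (A^T *m S a *m B) b c.
Proof.
rewrite tensor3_sumE [RHS]mxE exchange_big /=.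
transitivity (\sum_j \sum_k \sum_l \sum_i (A i j * B k l) *
    (S a i k * (b == j)%:R * (c == l)%:R)).
  apply: eq_bigr => j _; rewrite exchange_big; apply: eq_bigr => k _.
  rewrite exchange_big; apply: eq_bigr => l _; apply: eq_bigr => i _.
  by rewrite !ffunE /= !cb_vb [S a _ _]mxE.
transitivity (\sum_j (\sum_k \sum_i A i j * B k c * S a i k) * (b == j)%:R); last first.
  rewrite sum_deltar; apply: eq_bigr => k _; rewrite [(_ *m _) _ _]mxE mulr_suml.
  by apply: eq_bigr => i _; rewrite [_^T _ _]mxE; ring.
apply: eq_bigr => j _; rewrite mulr_suml; apply: eq_bigr => k _.
transitivity (\sum_l ((\sum_i A i j * B k l * S a i k) * (b == j)%:R) * (c == l)%:R).
  apply: eq_bigr => l _; rewrite !mulr_suml; apply: eq_bigr => i _; ring.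
by rewrite sum_deltar.
Qed.

Lemma br12_23E A B a b c : br12_23 br A B (a, b, c) = (A *m S b *m B) a c.
Proof.
rewrite tensor3_sumE [RHS]mxE.
transitivity (\sum_i (\sum_k \sum_j A i j * S b j k * B k c) * (a == i)%:R); last first.
  rewrite sum_deltar; apply: eq_bigr => k _; rewrite [(_ *m _) _ _]mxE mulr_suml.
  by apply: eq_bigr => i _.
apply: eq_bigr => i _; rewrite exchange_big mulr_suml; apply: eq_bigr => k _.
rewrite exchange_big.
transitivity (\sum_l ((\sum_j A i j * S b j k * B k l) * (a == i)%:R) * (c == l)%:R).
  apply: eq_bigr => l _; rewrite !mulr_suml; apply: eq_bigr => j _.
  by rewrite !ffunE /= !cb_vb [S b _ _]mxE /GRing.scale /=; ring.
by rewrite sum_deltar.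
Qed.

Lemma br13_23E A B a b c : br13_23 br A B (a, b, c) = (A *m S c *m B^T) a b.
Proof.
rewrite tensor3_sumE [RHS]mxE.
transitivity (\sum_i (\sum_l \sum_j A i j * S c j l * B b l) * (a == i)%:R); last first.
  rewrite sum_deltar; apply: eq_bigr => k _; rewrite [(_ *m _) _ _]mxE mulr_suml.
  by apply: eq_bigr => i _; rewrite [_^T _ _]mxE.
apply: eq_bigr => i _; under eq_bigr do rewrite exchange_big.
rewrite exchange_big mulr_suml; apply: eq_bigr => l _; rewrite mulr_suml.
apply: eq_bigr => j _.
rewrite -[RHS](sum_deltar (fun k => A i j * S c j l * B k l * (a == i)%:R) b).
apply: eq_bigr => k _.
by rewrite !ffunE /= !cb_vb [S c _ _]mxE /GRing.scale /=; ring.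
Qed.

Lemma tensor3P (s t : tensor3 g) : (forall a b c, s (a, b, c) = t (a, b, c)) -> s = t.
Proof. by move=> e; apply/ffunP => -[[a b] c]. Qed.

Lemma tensor3D (s t : tensor3 g) x : (s + t) x = s x + t x.
Proof. by rewrite ffunE. Qed.

Lemma tensor3_0 x : (0 : tensor3 g) x = 0.
Proof. by rewrite ffunE. Qed.

Lemma cybe_entry (A12 A13 A23 : 'M[R[i]]_N) a b c :
  (br12_13 br A12 A13 + br12_23 br A12 A23 + br13_23 br A13 A23) (a, b, c) =
  (A12^T *m S a *m A13) b c + (A12 *m S b *m A23) a c + (A13 *m S c *m A23^T) a b.
Proof.
rewrite !tensor3D; congr (_ + _ + _).
- exact: br12_13E.
- exact: br12_23E.
- exact: br13_23E.
Qed.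

(** Each of the three brackets is, with one index fixed, a product of matrices. *)
Lemma cybe_mxP (A12 A13 A23 : 'M[R[i]]_N) :
  br12_13 br A12 A13 + br12_23 br A12 A23 + br13_23 br A13 A23 = 0 <->
  forall a b c, (A12^T *m S a *m A13) b c + (A12 *m S b *m A23) a c +
    (A13 *m S c *m A23^T) a b = 0.
Proof.
split=> [e a b c|e].
  have := congr1 (fun t : tensor3 g => t (a, b, c)) e.
  by rewrite cybe_entry tensor3_0.
by apply: tensor3P => a b c; rewrite cybe_entry tensor3_0.
Qed.

(** In each term two automorphisms meet at a structure matrix, and aut_mx turns
    them into a single one acting on the index left over. *)
Lemma cybe_aut M1 M2 M3 A12 A13 A23 :
  aut_mx br M1 -> aut_mx br M2 -> aut_mx br M3 ->
  br12_13 br A12 A13 + br12_23 br A12 A23 + br13_23 br A13 A23 = 0 ->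
  br12_13 br (M1^T *m A12 *m M2) (M1^T *m A13 *m M3) +
  br12_23 br (M1^T *m A12 *m M2) (M2^T *m A23 *m M3) +
  br13_23 br (M1^T *m A13 *m M3) (M2^T *m A23 *m M3) = 0.
Proof.
move=> a1 a2 a3 /cybe_mxP e; apply/cybe_mxP => a b c.
pose T m n o := (A12^T *m S m *m A13) n o + (A12 *m S n *m A23) m o +
    (A13 *m S o *m A23^T) m n.
suff -> : ((M1^T *m A12 *m M2)^T *m S a *m (M1^T *m A13 *m M3)) b c +
    (M1^T *m A12 *m M2 *m S b *m (M2^T *m A23 *m M3)) a c +
    (M1^T *m A13 *m M3 *m S c *m (M2^T *m A23 *m M3)^T) a b =
    \sum_m \sum_n \sum_o M1 m a * M2 n b * M3 o c * T m n o.
  by apply: big1 => m _; apply: big1 => n _; apply: big1 => o _; rewrite /T e mulr0.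
have tri (P Q X : 'M[R[i]]_N) i j : (P^T *m X *m Q) i j = \sum_k \sum_l P k i * Q l j * X k l.
  rewrite mxE exchange_big; apply: eq_bigr => l _; rewrite mxE mulr_suml.
  by apply: eq_bigr => k _; rewrite [_^T _ _]mxE; ring.
have sumS (P Q : 'M[R[i]]_N) (cc : 'I_N -> R[i]) i j :
    (P *m (\sum_m cc m *: S m) *m Q) i j = \sum_m cc m * (P *m S m *m Q) i j.
  rewrite mulmx_sumr mulmx_suml -sum_scale_mxE; congr (fun_of_matrix _ i j).
  by apply: eq_bigr => m _; rewrite -scalemxAr -scalemxAl.
have -> : (M1^T *m A12 *m M2)^T *m S a *m (M1^T *m A13 *m M3) =
   M2^T *m (A12^T *m (\sum_m M1 m a *: S m) *m A13) *m M3.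
  by rewrite a1 !trmx_mul !trmxK !mulmxA.
have -> : M1^T *m A12 *m M2 *m S b *m (M2^T *m A23 *m M3) =
   M1^T *m (A12 *m (\sum_m M2 m b *: S m) *m A23) *m M3.
  by rewrite a2 !mulmxA.
have -> : M1^T *m A13 *m M3 *m S c *m (M2^T *m A23 *m M3)^T =
   M1^T *m (A13 *m (\sum_m M3 m c *: S m) *m A23^T) *m M2.
  by rewrite a3 !trmx_mul !trmxK !mulmxA.
rewrite !tri.
transitivity (\sum_m \sum_n \sum_o (M1 m a * M2 n b * M3 o c * (A12^T *m S m *m A13) n o) +
  \sum_m \sum_n \sum_o (M1 m a * M2 n b * M3 o c * (A12 *m S n *m A23) m o) +
  \sum_m \sum_n \sum_o (M1 m a * M2 n b * M3 o c * (A13 *m S o *m A23^T) m n)); last first.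
  rewrite -!big_split; apply: eq_bigr => m _; rewrite -!big_split; apply: eq_bigr => n _.
  by rewrite -!big_split; apply: eq_bigr => o _; rewrite /T /= !mulrDr.
congr (_ + _ + _).
- under eq_bigr do under eq_bigr do rewrite sumS mulr_sumr.
  under eq_bigr do rewrite exchange_big.
  rewrite exchange_big; apply: eq_bigr => m _; apply: eq_bigr => n _.
  by apply: eq_bigr => o _; ring.
- under eq_bigr do under eq_bigr do rewrite sumS mulr_sumr.
  apply: eq_bigr => m _; rewrite exchange_big; apply: eq_bigr => n _.
  by apply: eq_bigr => o _; ring.
- under eq_bigr do under eq_bigr do rewrite sumS mulr_sumr.
  apply: eq_bigr => m _; apply: eq_bigr => n _; apply: eq_bigr => o _; ring.
Qed.

(** Applying the bracket to the last two tensor factors. *)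
Definition contract23 (T : 'I_N -> 'I_N -> 'I_N -> R[i]) : 'M[R[i]]_N :=
  \matrix_(a, m) \sum_b \sum_c T a b c * S m b c.

Definition con12_13 A B := contract23 (fun a b c => (A^T *m S a *m B) b c).
Definition con12_23 A B := contract23 (fun a b c => (A *m S b *m B) a c).
Definition con13_23 A B := contract23 (fun a b c => (A *m S c *m B^T) a b).

Lemma con12_13_entry A B a m : con12_13 A B a m =
  \sum_b \sum_c (A^T *m S a *m B) b c * S m b c.
Proof. by rewrite mxE. Qed.

Lemma con12_23_entry A B a m : con12_23 A B a m =
  \sum_b \sum_c (A *m S b *m B) a c * S m b c.
Proof. by rewrite mxE. Qed.

Lemma con13_23_entry A B a m : con13_23 A B a m =
  \sum_b \sum_c (A *m S c *m B^T) a b * S m b c.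
Proof. by rewrite mxE. Qed.

Lemma con12_13_trace A B a m : con12_13 A B a m = \tr (A^T *m S a *m B *m (S m)^T).
Proof.
rewrite mxE; apply: eq_bigr => b _; rewrite [RHS]mxE.
by apply: eq_bigr => c _; rewrite [(S m)^T _ _]mxE.
Qed.

(** The contraction is a trace, invariant under transposition and cyclic
    permutation. *)
Lemma con12_13_tr A B : (con12_13 A B)^T = con12_13 A^T B^T.
Proof.
apply/matrixP => a m; rewrite [LHS]mxE !con12_13_trace trmxK.
by rewrite -[RHS]mxtrace_tr !trmx_mul !trmxK !mulmxA [RHS]mxtrace_mulC !mulmxA.
Qed.

Lemma con12_13NN A B : con12_13 (- A) (- B) = con12_13 A B.
Proof.
apply/matrixP => a m; rewrite !con12_13_trace.
have -> : (- A)^T = - A^T by apply/matrixP => i j; rewrite !mxE.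
by rewrite !(mulNmx, mulmxN) opprK.
Qed.

End TensorBrackets.

(** * The Killing form and the Casimir element *)

Section Casimir.
Variables (R : realType) (g : vectType R[i]) (br : g -> g -> g).
Variable Omega : 'M[R[i]]_(\dim {:g}).
Hypothesis brL : is_lie_bracket br.
Hypothesis casimir : quadratic_casimir br Omega.
Local Notation N := (\dim {:g}).
Local Notation S := (str_mx br).
Implicit Types (x y z : g) (A B M : 'M[R[i]]_N).

Lemma killingE x y : killing br x y = \tr (ad_mx br y *m ad_mx br x).
Proof. by rewrite /killing end_mx_comp. Qed.

Lemma killing_sym x y : killing br x y = killing br y x.
Proof. by rewrite !killingE mxtrace_mulC. Qed.

Lemma killing_sum n (F : 'I_n -> g) y :
  killing br (\sum_i F i) y = \sum_i killing br (F i) y.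
Proof.
rewrite killingE (ad_mx_sum brL) mulmx_sumr raddf_sum; apply: eq_bigr => i _.
by rewrite killingE.
Qed.

Lemma killing_suml n (c : 'I_n -> R[i]) (F : 'I_n -> g) y :
  killing br (\sum_i c i *: F i) y = \sum_i c i * killing br (F i) y.
Proof.
rewrite killing_sum; apply: eq_bigr => i _.
by rewrite killingE (ad_mxZ brL) -scalemxAr mxtraceZ -killingE.
Qed.

Lemma killing_sumr n (c : 'I_n -> R[i]) (F : 'I_n -> g) y :
  killing br y (\sum_i c i *: F i) = \sum_i c i * killing br y (F i).
Proof.
by rewrite killing_sym killing_suml; apply: eq_bigr => i _; rewrite killing_sym.
Qed.

Lemma killing_inv x y z : killing br (br x y) z = killing br x (br y z).
Proof.
rewrite (killingE (br x y)) (killingE x) (ad_mx_br brL x) (ad_mx_br brL y).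
rewrite mulmxBr mulmxBl [LHS]raddfB [RHS]raddfB /= !mulmxA.
by congr (_ - _); rewrite mxtrace_mulC mulmxA.
Qed.

(** The Gram matrix of the Killing form; the Casimir tensor is its inverse. *)
Definition killing_mx : 'M[R[i]]_N := \matrix_(i, j) killing br (vb i) (vb j).

Lemma killing_coord x y :
  killing br x y = \sum_i \sum_j cb i x * cb j y * killing_mx i j.
Proof.
rewrite {1}(vb_decomp x) killing_suml; apply: eq_bigr => i _.
rewrite {1}(vb_decomp y) killing_sumr mulr_sumr; apply: eq_bigr => j _.
by rewrite mxE mulrA.
Qed.

Let casimir_factor : exists P : 'M[R[i]]_N,
  Omega = P^T *m P /\ P *m killing_mx *m P^T = 1%:M.
Proof.
case: casimir => I [_ ortho ->].
exists (\matrix_(m, a) cb a I`_m); split.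
  apply/matrixP => i j; rewrite summxE mxE; apply: eq_bigr => m _.
  by rewrite [LHS]mxE [_^T _ _]mxE ![(\matrix_(_, _) _) _ _]mxE.
apply/matrixP => m n; rewrite [RHS]mxE -ortho killing_coord mxE exchange_big.
apply: eq_bigr => j _; rewrite mxE mulr_suml; apply: eq_bigr => i _.
by rewrite [_^T _ _]mxE ![(\matrix_(_, a) cb a I`_ _) _ _]mxE; ring.
Qed.

Lemma casimir_killing : Omega *m killing_mx = 1%:M.
Proof.
have [P [-> e]] := casimir_factor; rewrite -mulmxA.
exact: mulmx1C e.
Qed.

Lemma killing_casimir : killing_mx *m Omega = 1%:M.
Proof. exact: mulmx1C casimir_killing. Qed.

Lemma casimir_unit : Omega \in unitmx.
Proof. by case/mulmx1_unit: casimir_killing. Qed.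

Lemma casimir_tr : Omega^T = Omega.
Proof. by have [P [-> _]] := casimir_factor; rewrite trmx_mul trmxK. Qed.

(** Invariance of the Killing form, in coordinates. *)
Lemma killing_mx_ad x : ad_mx br x *m killing_mx + killing_mx *m (ad_mx br x)^T = 0.
Proof.
apply/matrixP => i k; rewrite [RHS]mxE [LHS]mxE.
have -> : (ad_mx br x *m killing_mx) i k = killing br (br x (vb i)) (vb k).
  rewrite (vb_decomp (br x (vb i))) killing_suml mxE; apply: eq_bigr => a _.
  by rewrite (ad_mxE brL) [killing_mx _ _]mxE.
have -> : (killing_mx *m (ad_mx br x)^T) i k = killing br (vb i) (br x (vb k)).
  rewrite (vb_decomp (br x (vb k))) killing_sumr mxE; apply: eq_bigr => a _.
  by rewrite [_^T _ _]mxE (ad_mxE brL) [killing_mx _ _]mxE mulrC.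
rewrite (br_anti brL x (vb i)) -scaleN1r.
have -> : killing br (-1 *: br (vb i) x) (vb k) = - killing br (br (vb i) x) (vb k).
  by rewrite !killingE (ad_mxZ brL) -scalemxAr mxtraceZ mulN1r.
by rewrite killing_inv addNr.
Qed.

(** Invariance passes from the Killing form to the inverse of its Gram matrix. *)
Lemma casimir_ad x : Omega *m ad_mx br x + (ad_mx br x)^T *m Omega = 0.
Proof.
have := congr1 (fun M => Omega *m M *m Omega) (killing_mx_ad x).
rewrite mulmx0 mul0mx mulmxDr mulmxDl -!mulmxA killing_casimir mulmx1.
by rewrite (mulmxA Omega killing_mx) casimir_killing mul1mx.
Qed.

(** Both sides have the same Killing product with every z, which is a trace. *)
Lemma casimir_action x :
  \sum_k \sum_c Omega k c *: br (br x (vb k)) (vb c) = x.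
Proof.
set v := LHS.
have vz z : killing br v z = killing br x z.
  have -> : killing br v z = \sum_k \sum_c Omega k c * killing br (vb c) (br z (br x (vb k))).
    rewrite /v killing_sum; apply: eq_bigr => k _.
    rewrite killing_suml; apply: eq_bigr => c _; congr (_ * _).
    by rewrite killing_inv killing_sym killing_inv.
  rewrite [RHS]killing_sym [RHS]killingE; apply: eq_bigr => k _.
  transitivity (cb k (br z (br x (vb k)))); last first.
    by rewrite (cb_br_ad brL) mxE; apply: eq_bigr => j _; rewrite (ad_mxE brL x).
  transitivity (\sum_j cb j (br z (br x (vb k))) * (Omega *m killing_mx) k j); last first.
    rewrite casimir_killing; under eq_bigr do rewrite mxE.
    exact: sum_deltar.
  under [RHS]eq_bigr do rewrite mxE mulr_sumr.
  rewrite exchange_big; apply: eq_bigr => c _.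
  rewrite {1}(vb_decomp (br z _)) killing_sumr mulr_sumr; apply: eq_bigr => j _.
  by rewrite mxE; ring.
pose row x := \row_i cb i x : 'rV[R[i]]_N.
have rowK y : row y *m killing_mx = \row_j killing br y (vb j).
  apply/rowP => j; rewrite !mxE {2}(vb_decomp y) killing_suml.
  by apply: eq_bigr => i _; rewrite !mxE.
have uK : killing_mx \in unitmx by case/mulmx1_unit: casimir_killing.
have : row v = row x.
  by apply: (can_inj (mulmxK uK)); rewrite !rowK; apply/rowP => j; rewrite !mxE vz.
by move=> e; apply: cb_inj => i; have /rowP/(_ i) := e; rewrite !mxE.
Qed.

Lemma con12_23E A B a m : con12_23 br A B a m =
  \sum_j \sum_k \sum_c A a j * (B k c * cb m (br (br (vb j) (vb k)) (vb c))).
Proof.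
rewrite mxE.
transitivity (\sum_b \sum_c \sum_k \sum_j A a j * S b j k * B k c * S m b c).
  apply: eq_bigr => b _; apply: eq_bigr => c _; rewrite mxE mulr_suml.
  apply: eq_bigr => k _; rewrite [(_ *m _) _ _]mxE !mulr_suml.
  by apply: eq_bigr => j _.
transitivity (\sum_j \sum_k \sum_c \sum_b A a j * S b j k * B k c * S m b c).
  under eq_bigr do under eq_bigr do rewrite exchange_big.
  under eq_bigr do rewrite exchange_big.
  rewrite exchange_big; apply: eq_bigr => j _.
  under eq_bigr do rewrite exchange_big.
  rewrite exchange_big; apply: eq_bigr => k _.
  by rewrite exchange_big.
apply: eq_bigr => j _; apply: eq_bigr => k _; apply: eq_bigr => c _.
rewrite (vb_decomp (br (vb j) (vb k))) (br_suml brL) cb_sum !mulr_sumr.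
apply: eq_bigr => b _; rewrite (brZl brL) cbZ [S b _ _]mxE [S m _ _]mxE; ring.
Qed.

Lemma con13_23E A B a m : con13_23 br A B a m =
  \sum_j \sum_b \sum_l A a j * (B b l * cb m (br (vb b) (br (vb j) (vb l)))).
Proof.
rewrite mxE.
transitivity (\sum_b \sum_c \sum_l \sum_j A a j * S c j l * B b l * S m b c).
  apply: eq_bigr => b _; apply: eq_bigr => c _; rewrite mxE mulr_suml.
  apply: eq_bigr => l _; rewrite [(_ *m _) _ _]mxE [_^T _ _]mxE !mulr_suml.
  by apply: eq_bigr => j _.
transitivity (\sum_j \sum_b \sum_l \sum_c A a j * S c j l * B b l * S m b c).
  under eq_bigr do under eq_bigr do rewrite exchange_big.
  under eq_bigr do rewrite exchange_big.
  rewrite exchange_big; apply: eq_bigr => j _; apply: eq_bigr => b _.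
  by rewrite exchange_big.
apply: eq_bigr => j _; apply: eq_bigr => b _; apply: eq_bigr => l _.
rewrite (vb_decomp (br (vb j) (vb l))) (br_sumr brL) cb_sum !mulr_sumr.
apply: eq_bigr => c _; rewrite (brZr brL) cbZ [S c _ _]mxE [S m _ _]mxE; ring.
Qed.

Lemma con12_23_casimir A : con12_23 br A Omega = A.
Proof.
apply/matrixP => a m; rewrite con12_23E.
transitivity (\sum_j A a j * cb m (vb j : g)); last first.
  by under eq_bigr do rewrite cb_vb; exact: sum_deltar.
apply: eq_bigr => j _; rewrite -[vb j in RHS]casimir_action cb_sum mulr_sumr.
apply: eq_bigr => k _; rewrite cb_sum mulr_sumr; apply: eq_bigr => c _.
by rewrite cbZ.
Qed.

Definition tensor_bracket B : g := \sum_k \sum_l B k l *: br (vb k) (vb l).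

(** Jacobi: x acts on the tensor B and the bracket is equivariant. *)
Lemma con23_bracket A B : con12_23 br A B + con13_23 br A B =
  - (A *m ad_mx br (tensor_bracket B)).
Proof.
apply/matrixP => a m; rewrite mxE con12_23E con13_23E -big_split [RHS]mxE [X in - X]mxE.
rewrite -sumrN; apply: eq_bigr => j _ /=.
rewrite -mulrN (ad_mxE brL) -cbN -(br_anti brL) /tensor_bracket (br_sumr brL) cb_sum.
rewrite mulr_sumr -big_split; apply: eq_bigr => k _ /=.
rewrite (br_sumr brL) cb_sum mulr_sumr -big_split; apply: eq_bigr => l _ /=.
by rewrite (brZr brL) cbZ (br_der brL (vb j) (vb k)) cbD !mulrDr.
Qed.

(** Invariance of the Casimir tensor, with x running through the second factor
    of A. *)
Lemma casimir_invariance A : con12_23 br A Omega + con13_23 br A Omega = 0.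
Proof.
apply/matrixP => a m; rewrite [LHS]mxE [RHS]mxE !mxE -big_split; apply: big1 => b _ /=.
rewrite -big_split; apply: big1 => c _ /=; rewrite -mulrDl.
suff -> : (A *m S b *m Omega) a c + (A *m S c *m Omega^T) a b = 0 by rewrite mul0r.
rewrite casimir_tr -!mulmxA [X in X + _]mxE [X in _ + X]mxE -big_split.
apply: big1 => j _ /=; rewrite -mulrDr.
suff -> : (S b *m Omega) j c + (S c *m Omega) j b = 0 by rewrite mulr0.
have e d e : (S d *m Omega) j e = ((ad_mx br (vb j))^T *m Omega) d e.
  by rewrite !mxE; apply: eq_bigr => k _; rewrite [_^T _ _]mxE (ad_mxE brL) [S d _ _]mxE.
have := congr1 (fun M : 'M[R[i]]_N => M b c) (casimir_ad (vb j)).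
rewrite [X in X = _]mxE [X in _ = X]mxE !e => e0; rewrite -[RHS]e0 addrC; congr (_ + _).
have -> : Omega *m ad_mx br (vb j) = ((ad_mx br (vb j))^T *m Omega)^T.
  by rewrite trmx_mul trmxK casimir_tr.
by rewrite [RHS]mxE.
Qed.

End Casimir.

(** * Derivatives of matrices and of X *)

Section MatrixDerivative.
Variables (R : realType) (N : nat).
Implicit Types (F G : R[i] -> 'M[R[i]]_N) (D E M : 'M[R[i]]_N) (f : R[i] -> R[i]) (z : R[i]).

Lemma mcderM F G z D E : mcder F z D -> mcder G z E ->
  mcder (fun x => F x *m G x) z (D *m G z + F z *m E).
Proof.
move=> dF dG i j.
apply: (@cder_ext _ (fun x => \sum_k F x i k * G x k j)) => [x|]; first by rewrite mxE.
apply: cder_eq (cder_sum (fun k => cderM (dF i k) (dG k j))) _.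
by rewrite big_split !mxE.
Qed.

Lemma mcderN F z D : mcder F z D -> mcder (fun x => - F x) z (- D).
Proof.
move=> dF i j; apply: (@cder_ext _ (fun x => - F x i j)) => [x|]; first by rewrite mxE.
by rewrite mxE; apply: cderN.
Qed.

Lemma mcderD F G z D E : mcder F z D -> mcder G z E -> mcder (fun x => F x + G x) z (D + E).
Proof.
move=> dF dG i j.
apply: (@cder_ext _ (fun x => F x i j + G x i j)) => [x|]; first by rewrite mxE.
by rewrite mxE; apply: cderD.
Qed.

Lemma mcder_tr F z D : mcder F z D -> mcder (fun x => (F x)^T) z D^T.
Proof.
move=> dF i j; apply: (@cder_ext _ (fun x => F x j i)) => [x|]; first by rewrite mxE.
by rewrite mxE; apply: dF.
Qed.

Lemma mcder_cst M z : mcder (fun=> M) z 0.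
Proof. by move=> i j; rewrite mxE; exact: cder_cst. Qed.

Lemma mcderZ f F z d D : cder f z d -> mcder F z D ->
  mcder (fun x => f x *: F x) z (d *: F z + f z *: D).
Proof.
move=> df dF i j; apply: (@cder_ext _ (fun x => f x * F x i j)) => [x|].
  by rewrite mxE.
by rewrite !mxE; apply: cderM.
Qed.

Lemma mcder_comp F f z d D : cder f z d -> mcder F (f z) D ->
  mcder (fun x => F (f x)) z (d *: D).
Proof.
move=> df dF i j; rewrite mxE mulrC.
exact: (cder_comp (f := fun x => F x i j) df (dF i j)).
Qed.

Lemma mcder_eq F z D E : mcder F z D -> D = E -> mcder F z E.
Proof. by move=> dF <-. Qed.

Lemma mcder_sum n (F : 'I_n -> R[i] -> 'M[R[i]]_N) z (D : 'I_n -> 'M[R[i]]_N) :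
  (forall k, mcder (F k) z (D k)) -> mcder (fun x => \sum_k F k x) z (\sum_k D k).
Proof.
move=> dF i j; apply: (@cder_ext _ (fun x => \sum_k F k x i j)) => [x|].
  by rewrite summxE.
by rewrite summxE; apply: cder_sum => k; exact: dF.
Qed.

Lemma mcder0_const F : (forall z, mcder F z 0) -> forall z w, F z = F w.
Proof.
move=> dF z w; apply/matrixP => i j.
by apply: (cder0_const (f := fun x => F x i j)) => x; have := dF x i j; rewrite mxE.
Qed.

End MatrixDerivative.

Section BivariatePolynomial.
Variable R : realType.
Implicit Types (f : R[i] -> R[i]) (q : {poly {poly R[i]}}).

Lemma cder_horner (c : {poly R[i]}) f t d : cder f t d ->
  cder (fun s => c.[f s]) t (d * c^`().[f t]).
Proof.
move=> df; elim/poly_ind: c => [|c k IH].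
  apply: (@cder_ext _ (fun=> 0)) => [s|]; first by rewrite horner0.
  by rewrite deriv0 horner0 mulr0; exact: cder_cst.
apply: (@cder_ext _ (fun s => c.[f s] * f s + k)) => [s|]; first by rewrite hornerMXaddC.
apply: cder_eq (cderD (cderM IH df) (cder_cst k t)) _.
by rewrite derivMXaddC !hornerE; ring.
Qed.

Lemma cder_horner2 q f h t d e : cder f t d -> cder h t e ->
  cder (fun s => q.[f s, h s]) t
    (d * q^`().[f t, h t] + e * (q.[(f t)%:P])^`().[h t]).
Proof.
move=> df dh; elim/poly_ind: q => [|q k IH].
  apply: (@cder_ext _ (fun=> 0)) => [s|]; first by rewrite !horner0.
  by rewrite deriv0 !horner0 deriv0 horner0 !mulr0 addr0; exact: cder_cst.
apply: (@cder_ext _ (fun s => q.[f s, h s] * f s + k.[h s])) => [s|].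
  by rewrite hornerMXaddC hornerD hornerM hornerC.
apply: cder_eq (cderD (cderM IH df) (cder_horner k dh)) _.
rewrite derivMXaddC hornerMXaddC derivD derivM derivC mulr0 addr0.
by rewrite !(hornerD, hornerM, hornerX, hornerC); ring.
Qed.

Lemma horner_diag q v : q.['X].[v] = q.[v, v].
Proof.
elim/poly_ind: q => [|q k IH]; first by rewrite !horner0.
by rewrite !hornerMXaddC !hornerD !hornerM IH hornerX hornerC.
Qed.

End BivariatePolynomial.

Section QuasiTrigonometric.
Variables (R : realType) (g : vectType R[i]) (br : g -> g -> g).
Local Notation N := (\dim {:g}).
Variables (Omega : 'M[R[i]]_N) (p : 'M[{poly {poly R[i]}}]_N).
Hypothesis brL : is_lie_bracket br.
Hypothesis casimir : quadratic_casimir br Omega.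
Local Notation X := (quasi_trig_fun Omega p).
Hypothesis cybe : cybe_two_param br X.
Implicit Types (u v t : R[i]).

Definition poly_part u v : 'M[R[i]]_N := map_mx (fun q => q.[u, v]) p.

(** The partial derivatives of X off the diagonal, written out. *)
Definition partial1 u v : 'M[R[i]]_N :=
  (- v / (u - v) ^+ 2) *: Omega + \matrix_(i, j) (p i j)^`().[u, v].

Definition partial2 u v : 'M[R[i]]_N :=
  (u / (u - v) ^+ 2) *: Omega + \matrix_(i, j) ((p i j).[u%:P])^`().[v].

Lemma poly_part_mcder (f h : R[i] -> R[i]) t d e : cder f t d -> cder h t e ->
  mcder (fun s => poly_part (f s) (h s)) t
    (\matrix_(i, j) (d * (p i j)^`().[f t, h t] + e * ((p i j).[(f t)%:P])^`().[h t])).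
Proof.
move=> df dh i j; rewrite mxE.
apply: (@cder_ext _ (fun s => (p i j).[f s, h s])) => [s|]; first by rewrite mxE.
exact: cder_horner2.
Qed.

(** The chain rule for X along a curve (f, h) off the diagonal. *)
Lemma X_mcder (f h : R[i] -> R[i]) t d e : cder f t d -> cder h t e -> f t != h t ->
  mcder (fun s => X (f s) (h s)) t (d *: partial1 (f t) (h t) + e *: partial2 (f t) (h t)).
Proof.
move=> df dh fh; have fh0 : f t - h t != 0 by rewrite subr_eq0.
have dV := cderM dh (cderV (f := fun s => f s - h s) fh0 (cderB df dh)).
apply: mcder_eq (mcderD (mcderZ dV (mcder_cst Omega t)) (poly_part_mcder df dh)) _.
apply/matrixP => i j; rewrite /partial1 /partial2 !mxE.
by field.
Qed.

(** The element h(v) of the algebra that generates the gauge transformation. *)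
Definition bracket_at v : g := tensor_bracket br (poly_part v v).

Lemma X_split u v : X u v = (v / (u - v)) *: Omega + poly_part u v.
Proof. by []. Qed.

Lemma con12_23Dr A (B C : 'M[R[i]]_N) c : con12_23 br A (c *: B + C) =
  c *: con12_23 br A B + con12_23 br A C.
Proof.
apply/matrixP => a m; rewrite [RHS]mxE [X in _ = X + _]mxE !con12_23_entry.
rewrite mulr_sumr -big_split; apply: eq_bigr => b _ /=.
rewrite mulr_sumr -big_split; apply: eq_bigr => k _ /=.
by rewrite mulmxDr -scalemxAr [fun_of_matrix (_ + _) _ _]mxE [fun_of_matrix (c *: _) _ _]mxE; ring.
Qed.

Lemma con13_23Dr A (B C : 'M[R[i]]_N) c : con13_23 br A (c *: B + C) =
  c *: con13_23 br A B + con13_23 br A C.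
Proof.
apply/matrixP => a m; rewrite [RHS]mxE [X in _ = X + _]mxE !con13_23_entry.
have -> : (c *: B + C)^T = c *: B^T + C^T by apply/matrixP => x y; rewrite !mxE.
rewrite mulr_sumr -big_split; apply: eq_bigr => b _ /=.
rewrite mulr_sumr -big_split; apply: eq_bigr => k _ /=.
by rewrite mulmxDr -scalemxAr [fun_of_matrix (_ + _) _ _]mxE [fun_of_matrix (c *: _) _ _]mxE; ring.
Qed.

Lemma cybe_contracted A12 A13 A23 :
  br12_13 br A12 A13 + br12_23 br A12 A23 + br13_23 br A13 A23 = 0 ->
  con12_13 br A12 A13 + con12_23 br A12 A23 + con13_23 br A13 A23 = 0.
Proof.
move=> /cybe_mxP e; apply/matrixP => a m; rewrite [RHS]mxE [LHS]mxE [X in X + _]mxE.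
rewrite con12_13_entry con12_23_entry con13_23_entry -!big_split; apply: big1 => b _ /=.
by rewrite -!big_split; apply: big1 => c _ /=; rewrite -!mulrDl e mul0r.
Qed.

(** In the contracted equation at (u, t, v) the polar part v / (t - v) Omega of
    X t v contributes X u t - X u v, by invariance and con12_23_casimir; the
    pole along t = v is then cleared. *)
Lemma cybe_quotient u v t : u != v -> u != t -> t != v ->
  v *: (X u t - X u v) + (t - v) *: (con12_13 br (X u t) (X u v) +
    con12_23 br (X u t) (poly_part t v) + con13_23 br (X u v) (poly_part t v)) = 0.
Proof.
move=> uv ut tv; have tv0 : t - v != 0 by rewrite subr_eq0.
have := cybe_contracted (cybe.1 u t v ut uv tv).
rewrite [X t v]X_split con12_23Dr con13_23Dr (con12_23_casimir brL casimir).
have -> : con13_23 br (X u v) Omega = - X u v.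
  have := casimir_invariance brL casimir (X u v).
  by rewrite (con12_23_casimir brL casimir) => /eqP; rewrite addrC addr_eq0 => /eqP.
move=> e; apply: (scalerI (invr_neq0 tv0)); rewrite scaler0 -[RHS]e.
rewrite scalerDr !scalerA mulVf // scale1r scalerN [_^-1 * v]mulrC scalerBr.
move: (con12_13 _ _ _) (con12_23 _ _ _) (con13_23 _ _ _) (_ *: X u t) (_ *: X u v).
move=> A B C D E; apply/matrixP => i j; rewrite !mxE; ring.
Qed.

End QuasiTrigonometric.

(** * The dilation equation *)

Section Existence.
Variables (R : realType) (N : nat).
Implicit Types (f h : R[i] -> R[i]) (F G : R[i] -> 'M[R[i]]_N) (z : R[i]).

(** Derivatives whose value is irrelevant. *)
Definition cdiff f z := exists d, cder f z d.
Definition mdiff F z := exists D, mcder F z D.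

Lemma cdiff_sum n (f : 'I_n -> R[i] -> R[i]) z :
  (forall i, cdiff (f i) z) -> cdiff (fun x => \sum_i f i x) z.
Proof. by move=> /choice[d Hd]; exists (\sum_i d i); exact: cder_sum. Qed.

Lemma cdiffM f h z : cdiff f z -> cdiff h z -> cdiff (fun x => f x * h x) z.
Proof. by move=> [d df] [e dh]; eexists; exact: cderM df dh. Qed.

Lemma mdiff_entry F z : mdiff F z -> forall i j, cdiff (fun x => F x i j) z.
Proof. by move=> [D dF] i j; exists (D i j). Qed.

Lemma mdiffM F G z : mdiff F z -> mdiff G z -> mdiff (fun x => F x *m G x) z.
Proof. by move=> [D dF] [E dG]; eexists; exact: mcderM dF dG. Qed.

Lemma mdiff_tr F z : mdiff F z -> mdiff (fun x => (F x)^T) z.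
Proof. by move=> [D dF]; eexists; exact: mcder_tr dF. Qed.

Lemma mdiff_cst (M : 'M[R[i]]_N) z : mdiff (fun=> M) z.
Proof. by eexists; exact: mcder_cst. Qed.

Lemma mdiffD F G z : mdiff F z -> mdiff G z -> mdiff (fun x => F x + G x) z.
Proof. by move=> [D dF] [E dG]; eexists; exact: mcderD dF dG. Qed.

Lemma mdiffP F z : (forall i j, cdiff (fun x => F x i j) z) -> mdiff F z.
Proof.
move=> H; have /choice[D HD] : forall ij : 'I_N * 'I_N, exists d,
  cder (fun x => F x ij.1 ij.2) z d by move=> ij; exact: H.
by exists (\matrix_(i, j) D (i, j)) => i j; rewrite mxE; exact: (HD (i, j)).
Qed.

End Existence.

Section ContractDerivative.
Variables (R : realType) (g : vectType R[i]) (br : g -> g -> g).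
Local Notation N := (\dim {:g}).
Implicit Types (F G : R[i] -> 'M[R[i]]_N) (z : R[i]).

Lemma mdiff_contract23 (T : R[i] -> 'I_N -> 'I_N -> 'I_N -> R[i]) z :
  (forall a b c, cdiff (fun x => T x a b c) z) ->
  mdiff (fun x => contract23 br (T x)) z.
Proof.
move=> H; apply: mdiffP => a m.
have [d Hd] : cdiff (fun x => \sum_b \sum_c T x a b c * str_mx br m b c) z.
  apply: cdiff_sum => b; apply: cdiff_sum => c; apply: cdiffM; first exact: H.
  by exists 0; exact: cder_cst.
by exists d; apply: cder_ext Hd => x; rewrite mxE.
Qed.

Lemma mdiff_con12_13 F G z : mdiff F z -> mdiff G z ->
  mdiff (fun x => con12_13 br (F x) (G x)) z.
Proof.
move=> dF dG; apply: mdiff_contract23 => a b c.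
exact: (mdiff_entry (mdiffM (mdiffM (mdiff_tr dF) (mdiff_cst _ _)) dG)).
Qed.

Lemma mdiff_con12_23 F G z : mdiff F z -> mdiff G z ->
  mdiff (fun x => con12_23 br (F x) (G x)) z.
Proof.
move=> dF dG; apply: mdiff_contract23 => a b c.
exact: (mdiff_entry (mdiffM (mdiffM dF (mdiff_cst _ _)) dG)).
Qed.

Lemma mdiff_con13_23 F G z : mdiff F z -> mdiff G z ->
  mdiff (fun x => con13_23 br (F x) (G x)) z.
Proof.
move=> dF dG; apply: mdiff_contract23 => a b c.
exact: (mdiff_entry (mdiffM (mdiffM dF (mdiff_cst _ _)) (mdiff_tr dG))).
Qed.

End ContractDerivative.

Section EulerEquation.
Variables (R : realType) (g : vectType R[i]) (br : g -> g -> g).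
Local Notation N := (\dim {:g}).
Variables (Omega : 'M[R[i]]_N) (p : 'M[{poly {poly R[i]}}]_N).
Hypothesis brL : is_lie_bracket br.
Hypothesis casimir : quadratic_casimir br Omega.
Local Notation X := (quasi_trig_fun Omega p).
Hypothesis cybe : cybe_two_param br X.
Local Notation P := (poly_part p).
Local Notation X1 := (partial1 Omega p).
Local Notation X2 := (partial2 Omega p).
Local Notation H v := (ad_mx br (bracket_at br p v)).
Implicit Types (u v t : R[i]).

Lemma near_neq u v : u != v -> 0 < normc (u - v) /\
  forall t, normc (t - v) < normc (u - v) -> u != t.
Proof.
move=> uv; split; first by rewrite normc_gt0 subr_eq0.
by move=> t; apply: contraTneq => <-; rewrite ltxx.
Qed.

Lemma X_snd_mcder u v : u != v -> mcder (X u) v (X2 u v).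
Proof.
move=> uv; apply: mcder_eq (X_mcder Omega p (cder_cst u v) (cder_id v) uv) _.
by rewrite scale0r add0r scale1r.
Qed.

Lemma X_fst_mcder u v : u != v -> mcder (X^~ v) u (X1 u v).
Proof.
move=> uv; apply: mcder_eq (X_mcder Omega p (cder_id u) (cder_cst v u) uv) _.
by rewrite scale0r addr0 scale1r.
Qed.

(** Letting the second and third spectral parameters coincide in
    cybe_quotient: as its left side vanishes identically, so does its
    derivative at t = v. *)
Lemma partial2_eq u v : u != v ->
  v *: X2 u v = X u v *m H v - con12_13 br (X u v) (X u v).
Proof.
move=> uv.
have dX : mdiff (X u) v by eexists; exact: X_snd_mcder.
have dP : mdiff (fun t => P t v) v.
  by eexists; exact: poly_part_mcder (cder_id v) (cder_cst v v).
pose psi t := con12_13 br (X u t) (X u v) + con12_23 br (X u t) (P t v) +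
  con13_23 br (X u v) (P t v).
have [D dpsi] : mdiff psi v.
  apply: mdiffD; [apply: mdiffD|].
  - exact: mdiff_con12_13 dX (mdiff_cst _ _).
  - exact: mdiff_con12_23.
  - exact: mdiff_con13_23 (mdiff_cst _ _) dP.
have psi_v : psi v = con12_13 br (X u v) (X u v) - X u v *m H v.
  by rewrite /psi -addrA (con23_bracket brL).
pose phi t := v *: (X u t - X u v) + (t - v) *: psi t.
have dphi : mcder phi v (v *: X2 u v + psi v).
  have d1 := mcderZ (cder_cst v v) (mcderD (X_snd_mcder uv) (mcder_cst (- X u v) v)).
  have d2 := mcderZ (cderB (cder_id v) (cder_cst v v)) dpsi.
  apply: mcder_eq (mcderD d1 d2) _.
  by rewrite scale0r add0r addr0 subr0 scale1r subrr scale0r addr0.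
have [d0 near] := near_neq uv.
suff e : v *: X2 u v + psi v = 0.
  by apply/eqP; rewrite -subr_eq0 opprB -psi_v; apply/eqP.
apply/matrixP => i j; rewrite [RHS]mxE.
apply: (cder_unique (dphi i j)).
apply: (cder_near d0 _ (cder_cst 0 v)) => t tv.
have [->|ne] := eqVneq t v; first by rewrite /phi !subrr scale0r scaler0 addr0 mxE.
by rewrite /phi (cybe_quotient brL casimir cybe uv (near _ tv) ne) mxE.
Qed.

(** The same for the first variable, by skew-symmetry. *)
Lemma partial1_eq u v : u != v ->
  u *: X1 u v = (H u)^T *m X u v + con12_13 br (X u v) (X u v).
Proof.
move=> uv; have vu : v != u by rewrite eq_sym.
have skew s t : s != t -> X s t = - (X t s)^T by case: cybe => _; apply.
have [d0 near] := near_neq vu.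
have -> : X1 u v = - (X2 v u)^T.
  apply/matrixP => i j; apply: (cder_unique (X_fst_mcder uv i j)).
  apply: (cder_near d0 _ (mcderN (mcder_tr (X_snd_mcder vu)) i j)) => t tu.
  by rewrite [X t v]skew // eq_sym near.
rewrite scalerN.
have -> : u *: (X2 v u)^T = (u *: X2 v u)^T by apply/matrixP => i j; rewrite !mxE.
rewrite partial2_eq //.
have -> : (X v u *m H u - con12_13 br (X v u) (X v u))^T =
    (H u)^T *m (X v u)^T - (con12_13 br (X v u) (X v u))^T.
  by rewrite -trmx_mul; apply/matrixP => i j; rewrite !mxE.
rewrite con12_13_tr opprB addrC.
have -> : (X v u)^T = - X u v by rewrite [X u v]skew // opprK.
by rewrite con12_13NN mulmxN opprK.
Qed.

(** The quadratic terms of the two equations cancel. *)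
Lemma X_euler u v : u != v ->
  u *: X1 u v + v *: X2 u v = (H u)^T *m X u v + X u v *m H v.
Proof. by move=> uv; rewrite partial1_eq // partial2_eq // addrACA subrr addr0. Qed.

(** The dilation equation along the curve (e^(a + t), e^(b + t)). *)
Lemma X_flow_mcder a b t : cexp (a + t) != cexp (b + t) ->
  mcder (fun s => X (cexp (a + s)) (cexp (b + s))) t
    ((H (cexp (a + t)))^T *m X (cexp (a + t)) (cexp (b + t)) +
     X (cexp (a + t)) (cexp (b + t)) *m H (cexp (b + t))).
Proof.
move=> ne; rewrite -X_euler //.
have d c : cder (fun s => cexp (c + s)) t (cexp (c + t)).
  apply: cder_eq (cder_comp (f := @cexp R) _ (cexp_cder _)) (mulr1 _).
  by apply: cder_eq (cderD (cder_cst c t) (cder_id t)) (add0r _).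
exact: X_mcder (d a) (d b) ne.
Qed.

End EulerEquation.

(** * The gauge transformation *)

Section Gauge.
Variables (R : realType) (g : vectType R[i]) (br : g -> g -> g).
Local Notation N := (\dim {:g}).
Variables (Omega : 'M[R[i]]_N) (p : 'M[{poly {poly R[i]}}]_N).
Hypothesis brL : is_lie_bracket br.
Hypothesis casimir : quadratic_casimir br Omega.
Local Notation X := (quasi_trig_fun Omega p).
Hypothesis cybe : cybe_two_param br X.
Local Notation S := (str_mx br).
Implicit Types (u v w : R[i]).

Definition gauge_mx w : 'M[R[i]]_N := ad_mx br (bracket_at br p (cexp w)).

(** The series of e^(n w) has the coefficients n^m / m!. *)
Lemma horner_cexp_entire (q : {poly R[i]}) : exists c : nat -> R[i],
  entire_coef c /\ forall w, psum c w = q.[cexp w].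
Proof.
suff H n (a : nat -> R[i]) : exists c : nat -> R[i],
    entire_coef c /\ forall w, psum c w = \sum_(i < n) a i * cexp w ^+ i.
  have [c [ec Hc]] := H (size q) (fun i => q`_i).
  by exists c; split => // w; rewrite Hc horner_coef.
elim: n => [|n [c [ec Hc]]].
  exists (fun m => 0 * exp_coef R m); split; first exact: entireZ (@exp_coef_entire R).
  by move=> w; rewrite (entire_psumZ _ _ (@exp_coef_entire R)) mul0r big_ord0.
pose e m := exp_coef R m * n%:R ^+ m.
have ee : entire_coef e.
  move=> r r0; case: n {Hc} @e => [|n] e.
    exists 1 => -[|m]; last by rewrite /e expr0n mulr0 normc0 mul0r.
    by rewrite /e /exp_coef invr1 !expr0 mulr1 normc1 mulr1.
  have nr : 0 < n.+1%:R * r by rewrite mulr_gt0.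
  have [M HM] := @exp_coef_entire R _ nr; exists M => m; apply: le_trans (HM m).
  by rewrite /e normcM normcX normc_nat exprMn mulrA.
exists (fun m => c m + a n * e m); split; first exact: entireD ec (entireZ _ ee).
move=> w; rewrite (entire_psumD _ ec (entireZ _ ee)) Hc (entire_psumZ _ _ ee) big_ord_recr.
congr (_ + _ * _).
have -> : psum e w = psum (exp_coef R) (n%:R * w).
  rewrite /psum (_ : (fun m => e m * w ^+ m) =
    (fun m => exp_coef R m * (n%:R * w) ^+ m)) //.
  by apply/funext => m; rewrite /e exprMn mulrA.
rewrite -cexp_psum; elim: n {a c ec Hc e ee} => [|n IH]; first by rewrite mul0r cexp0.
by rewrite -natr1 mulrDl mul1r cexpD IH exprSr.
Qed.

Lemma gauge_mx_entire : exists hc : nat -> 'M[R[i]]_N,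
  entire_mx hc /\ forall w, mpsum hc w = gauge_mx w.
Proof.
pose q (ij : 'I_N * 'I_N) : {poly R[i]} :=
  \sum_k \sum_l cb ij.2 (br (br (vb k) (vb l)) (vb ij.1)) *: (p k l).['X].
have /choice[c Hc] ij := horner_cexp_entire (q ij).
exists (fun n => \matrix_(i, j) c (i, j) n); split=> [i j|w].
  have [ec _] := Hc (i, j).
  by have -> : (fun n => (\matrix_(i, j) c (i, j) n) i j) = c (i, j)
    by apply/funext => n; rewrite mxE.
apply/matrixP => i j; rewrite mxE /gauge_mx (ad_mxE brL).
have -> : (fun n => (\matrix_(i, j) c (i, j) n) i j) = c (i, j).
  by apply/funext => n; rewrite mxE.
have [_ ->] := Hc (i, j); rewrite /q horner_sum /bracket_at /tensor_bracket.
rewrite (br_suml brL) cb_sum; apply: eq_bigr => k _.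
rewrite horner_sum (br_suml brL) cb_sum; apply: eq_bigr => l _.
by rewrite hornerZ horner_diag (brZl brL) cbZ mxE mulrC.
Qed.

Lemma mcder_id_shift (F : R[i] -> 'M[R[i]]_N) c t D : mcder F (c + t) D ->
  mcder (fun s => F (c + s)) t D.
Proof.
move=> dF; apply: mcder_eq (mcder_comp (f := fun s => c + s) _ dF) (scale1r _).
exact: cder_eq (cderD (cder_cst c t) (cder_id t)) (add0r _).
Qed.

Section Solution.
Variables F G : R[i] -> 'M[R[i]]_N.
Hypothesis F0 : F 0 = 1%:M.
Hypothesis G0 : G 0 = 1%:M.
Hypothesis dF : forall w, mcder F w (F w *m gauge_mx w).
Hypothesis dG : forall w, mcder G w (- (gauge_mx w *m G w)).

Lemma gauge_inv w : F w *m G w = 1%:M.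
Proof.
rewrite (mcder0_const (F := fun w => F w *m G w) _ w 0) ?F0 ?G0 ?mulmx1 // => z.
apply: mcder_eq (mcderM (dF z) (dG z)) _.
by rewrite mulmxN mulmxA subrr.
Qed.

Lemma gauge_invr w : G w *m F w = 1%:M.
Proof. exact: mulmx1C (gauge_inv w). Qed.

(** Transporting the structure constants by F and back by its inverse G leaves
    them constant, because ad h is a derivation. *)
Lemma gauge_aut w : aut_mx br (F w).
Proof.
pose E m w := \sum_a G w a m *: (F w *m S a *m (F w)^T).
have dE m z : mcder (E m) z 0.
  have dterm a : mcder (fun w => G w a m *: (F w *m S a *m (F w)^T)) z
    ((- (gauge_mx z *m G z)) a m *: (F z *m S a *m (F z)^T) +
     G z a m *: (F z *m (gauge_mx z *m S a + S a *m (gauge_mx z)^T) *m (F z)^T)).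
    have d := mcderM (mcderM (dF z) (mcder_cst (S a) z)) (mcder_tr (dF z)).
    apply: mcder_eq (mcderZ (dG z a m) d) _; congr (_ + _ *: _).
    by rewrite mulmx0 addr0 mulmxDr mulmxDl !mulmxA trmx_mul !mulmxA.
  apply: mcder_eq (mcder_sum dterm) _; rewrite big_split /=.
  have -> : \sum_a (- (gauge_mx z *m G z)) a m *: (F z *m S a *m (F z)^T) =
      - \sum_b G z b m *: (F z *m (\sum_a gauge_mx z a b *: S a) *m (F z)^T).
    transitivity (\sum_a \sum_b - ((gauge_mx z a b * G z b m) *: (F z *m S a *m (F z)^T))).
      apply: eq_bigr => a _; rewrite mxE mxE scaleNr scaler_suml.
      by rewrite -sumrN.
    rewrite exchange_big -sumrN; apply: eq_bigr => b _ /=.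
    rewrite sumrN mulmx_sumr mulmx_suml scaler_sumr; congr (- _); apply: eq_bigr => a _.
    by rewrite -scalemxAr -scalemxAl scalerA mulrC.
  rewrite addrC -sumrB; apply: big1 => b _.
  by rewrite /gauge_mx (ad_mx_der brL) subrr.
have E0 m : E m w = S m.
  rewrite (mcder0_const (dE m) w 0) /E F0 G0 (bigD1 m) //= mxE eqxx scale1r.
  rewrite mul1mx trmx1 mulmx1 big1 ?addr0 // => a ne.
  by rewrite mxE (negbTE ne) scale0r.
move=> a.
under eq_bigr => m _ do rewrite -E0 /E scaler_sumr.
rewrite exchange_big (bigD1 a) //= [X in _ + X]big1 ?addr0 => [|b ne].
  under eq_bigr => m _ do rewrite scalerA mulrC.
  rewrite -scaler_suml.
  have := congr1 (fun M : 'M[R[i]]_N => M a a) (gauge_invr w).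
  by rewrite mxE [RHS]mxE eqxx => ->; rewrite scale1r.
under eq_bigr => m _ do rewrite scalerA mulrC.
rewrite -scaler_suml.
have := congr1 (fun M : 'M[R[i]]_N => M b a) (gauge_invr w).
by rewrite mxE [RHS]mxE (negbTE ne) => ->; rewrite scale0r.
Qed.

Lemma gauge_aut_inv w : aut_mx br (G w).
Proof. exact: aut_mx_inv (gauge_inv w) (gauge_aut w). Qed.

(** The gauge-transformed X along the diagonal flow is constant, so it only
    depends on the difference of the arguments. *)
Lemma gauge_difference a b : cexp a != cexp b ->
  (G a)^T *m X (cexp a) (cexp b) *m G b = (G (a - b))^T *m X (cexp (a - b)) 1.
Proof.
move=> ab.
pose W s := (G (a + s))^T *m X (cexp (a + s)) (cexp (b + s)) *m G (b + s).
have dW t : mcder W t 0.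
  have ne : cexp (a + t) != cexp (b + t).
    by rewrite !cexpD; apply: contra ab => /eqP/(mulIf (cexp_neq0 t)) ->.
  have dGs c := mcder_id_shift (dG (c + t)).
  apply: mcder_eq (mcderM (mcderM (mcder_tr (dGs a)) (X_flow_mcder brL casimir cybe ne)) (dGs b)) _.
  rewrite -!/(gauge_mx _).
  move: (gauge_mx (a + t)) (gauge_mx (b + t)) (G (a + t)) (G (b + t)) (X _ _).
  move=> Ha Hb Ga Gb XX.
 have -> : (- (Ha *m Ga))^T = - (Ga^T *m Ha^T).
    by rewrite -trmx_mul; apply/matrixP => i j; rewrite !mxE.
  rewrite mulmxDr !mulmxDl mulmxN !mulNmx !mulmxA.
  by rewrite addrA addNr add0r addrN.
have := mcder0_const dW 0 (- b).
by rewrite /W !addr0 subrr cexp0 G0 mulmx1.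
Qed.

End Solution.

(** F is the transpose of a solution of the transposed equation. The difference quotient Gq of G at the
    origin is again entire; it serves to remove the singularity at z = 1. *)
Lemma gauge_exists : exists F G Gq : R[i] -> 'M[R[i]]_N,
  [/\ F 0 = 1%:M, G 0 = 1%:M,
    forall w, mcder F w (F w *m gauge_mx w),
    forall w, mcder G w (- (gauge_mx w *m G w)) &
    (forall w, G w = 1%:M + w *: Gq w) /\ forall w, mdiff Gq w].
Proof.
have [hc [eh Hh]] := gauge_mx_entire.
pose hN n := - hc n; pose hT n := (hc n)^T.
have eN : entire_mx hN.
  move=> i j; have -> : (fun n => hN n i j) = (fun n => -1 * hc n i j).
    by apply/funext => n; rewrite /hN mxE mulN1r.
  exact: entireZ (eh i j).
have eT : entire_mx hT.
  move=> i j; have -> : (fun n => hT n i j) = (fun n => hc n j i).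
    by apply/funext => n; rewrite /hT mxE.
  exact: eh.
have HN w : mpsum hN w = - gauge_mx w.
  rewrite -Hh; apply/matrixP => i j; rewrite !mxE.
  have -> : (fun n => hN n i j) = (fun n => -1 * hc n i j).
    by apply/funext => n; rewrite /hN mxE mulN1r.
  by rewrite (entire_psumZ _ _ (eh i j)) mulN1r.
have HT w : mpsum hT w = (gauge_mx w)^T.
  rewrite -Hh; apply/matrixP => i j; rewrite !mxE.
  by congr (psum _ w); apply/funext => n; rewrite /hT mxE.
pose Gq w : 'M[R[i]]_N := \matrix_(i, j) psum (fun n => ode_coef hN n.+1 i j) w.
exists (fun w => (mpsum (ode_coef hT) w)^T), (mpsum (ode_coef hN)), Gq.
split=> [|||w|].
- by rewrite mpsum_ode_coef0 trmx1.
- exact: mpsum_ode_coef0.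
- move=> w; apply: mcder_eq (mcder_tr (mpsum_ode_cder w eT)) _.
  by rewrite HT trmx_mul trmxK.
- by apply: mcder_eq (mpsum_ode_cder w eN) _; rewrite HN mulNmx.
split=> w.
  apply/matrixP => i j; rewrite !mxE.
  by rewrite (entire_psum_shift _ (ode_coef_entire eN i j)) ode_coef0 mxE.
apply: mdiffP => i j; exists (psum (pdiff (fun n => ode_coef hN n.+1 i j)) w).
apply: (@cder_ext _ (psum (fun n => ode_coef hN n.+1 i j))) => [x|]; first by rewrite mxE.
exact: entire_cder (entire_shift (ode_coef_entire eN i j)).
Qed.

End Gauge.

(** * Descent to one spectral parameter *)

Section Holomorphy.
Variables (R : realType) (N : nat).
Implicit Types (F : R[i] -> 'M[R[i]]_N) (a z : R[i]).

(** Matrices carry the supremum norm, so a common radius for the finitely many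
    entries suffices. *)
Lemma mdiff_derivable F z : mdiff F z ->
  derivable (F : R[i]^o -> 'M[R[i]]_N) (z : R[i]^o) (1 : R[i]^o).
Proof.
move=> [D dF]; apply/cvg_ex; exists D; apply/cvg_ballP => e /ltC0[e0 ee].
have /choice[r Hr] : forall ij : 'I_N * 'I_N, exists r : R, 0 < r /\
    forall h, normc h < r -> normc (F (z + h) ij.1 ij.2 - F z ij.1 ij.2 - D ij.1 ij.2 * h)
      <= complex.Re e / 2 * normc h.
  move=> [i j]; have e2 : 0 < complex.Re e / 2 by rewrite divr_gt0.
  by have [r r0 H] := (cderP _ _ _).1 (dF i j) _ e2; exists r.
have [r0 r00 Hr0] : exists2 r0 : R, 0 < r0 & forall ij, r0 <= r ij.
  exists (\big[Num.min/1]_ij r ij).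
    by elim/big_ind: _ => // [x y x0 y0|ij _]; [rewrite lt_min x0|have [] := Hr ij].
  by move=> ij; rewrite bigmin_le_cond.
apply/near_normc_punctured; exists r0 => // h; rewrite subr0 => hr h0.
split; first by rewrite ee ltcR.
move=> i j; rewrite !mxE.
have [_ /(_ h (lt_le_trans hr (Hr0 (i, j)))) H] := Hr (i, j).
rewrite /ball /= ee.
rewrite [X in X < _](_ : _ = (normc (D i j - h^-1 * (F (h * 1 + z) i j - F z i j)))%:C).
  rewrite ltcR normcB mulr1 [h + z]addrC; apply: (@le_lt_trans _ _ (complex.Re e / 2)).
    rewrite -(ler_pM2l (x := normc h)) ?normc_gt0 // -normcM mulrBr mulVKf //.
    by rewrite [h * _]mulrC [leRHS]mulrC.
  by rewrite ltr_pdivrMr // ltr_pMr // ltr1n.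
by rewrite -normc_norm.
Qed.

Lemma mdiff_holomorphic F a (r : R) : 0 < r ->
  (forall z, normc (z - a) < r -> mdiff F z) -> holomorphic_at F a.
Proof.
move=> r0 H; apply/near_normcP; exists r => // z zr.
exact/mdiff_derivable/H.
Qed.

Lemma holomorphic_entry_continuous F a i j : holomorphic_at F a ->
  forall e : R, 0 < e -> exists2 r : R, 0 < r &
    forall z, normc (z - a) < r -> normc (F z i j - F a i j) < e.
Proof.
move=> /near_normcP[d d0 /(_ a)]; rewrite subrr normc0 => /(_ d0) dF e e0.
have cF := differentiable_continuous ((derivable1_diffP _ _).1 dF).
have /cvg_ballP/(_ e%:C) := cF.
rewrite ltcR => /(_ e0)/near_normcP[r r0 Hr]; exists r => // z /Hr[_ /(_ i j)].
by rewrite /ball /= => H; rewrite normcB -ltcR -normc_norm.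
Qed.

End Holomorphy.

Section NearLemmas.
Variable R : realType.
Implicit Types (f : R[i] -> R[i]) (a b c z : R[i]).

Lemma cdiff_neq_near f a c : cdiff f a -> f a != c ->
  exists2 r : R, 0 < r & forall z, normc (z - a) < r -> f z != c.
Proof.
move=> [d df] ne; have e0 : 0 < normc (f a - c) by rewrite normc_gt0 subr_eq0.
have [r r0 H] := cder_continuous df e0; exists r => // z zr.
by apply: contraTneq (H z zr) => ->; rewrite normcB ltxx.
Qed.

Lemma near2_normc a b (P : R[i] -> R[i] -> Prop) (d : R) : 0 < d ->
  (forall z w, normc (z - a) < d -> normc (w - b) < d -> P z w) ->
  \forall z \near (a : R[i]^o) & w \near (b : R[i]^o), P z w.
Proof.
move=> d0 H; exists ([set z | normc (z - a) < d], [set w | normc (w - b) < d]).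
  by split; apply/near_normcP; exists d.
by move=> [z w] [/= za wb]; exact: H.
Qed.

Lemma cdiff_bigsum (I : Type) (s : seq I) (F : I -> R[i] -> R[i]) z :
  (forall k, cdiff (F k) z) -> cdiff (fun x => \sum_(k <- s) F k x) z.
Proof.
move=> H; elim: s => [|k s [d IH]].
  by exists 0; apply: cder_ext (cder_cst 0 z) => x; rewrite big_nil.
have [e He] := H k; exists (e + d).
by apply: cder_ext (cderD He IH) => x; rewrite big_cons.
Qed.

Lemma cdiff_bigprod (I : Type) (s : seq I) (F : I -> R[i] -> R[i]) z :
  (forall k, cdiff (F k) z) -> cdiff (fun x => \prod_(k <- s) F k x) z.
Proof.
move=> H; elim: s => [|k s [d IH]].
  by exists 0; apply: cder_ext (cder_cst 1 z) => x; rewrite big_nil.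
have [e He] := H k; eexists.
by apply: cder_ext (cderM He IH) => x; rewrite big_cons.
Qed.

(** The determinant is a polynomial in the entries. *)
Lemma cdiff_det N (F : R[i] -> 'M[R[i]]_N) z : mdiff F z -> cdiff (fun x => \det (F x)) z.
Proof.
move=> dF; apply: cdiff_bigsum => s; apply: cdiffM; first by exists 0; exact: cder_cst.
by apply: cdiff_bigprod => i; exact: mdiff_entry.
Qed.

End NearLemmas.

Section Descent.
Variables (R : realType) (g : vectType R[i]) (br : g -> g -> g).
Local Notation N := (\dim {:g}).
Variables (Omega : 'M[R[i]]_N) (p : 'M[{poly {poly R[i]}}]_N).
Hypothesis brL : is_lie_bracket br.
Hypothesis casimir : quadratic_casimir br Omega.
Local Notation X := (quasi_trig_fun Omega p).
Hypothesis cybe : cybe_two_param br X.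
Variables F G Gq : R[i] -> 'M[R[i]]_N.
Hypothesis F0 : F 0 = 1%:M.
Hypothesis G0 : G 0 = 1%:M.
Hypothesis dF : forall w, mcder F w (F w *m gauge_mx br p w).
Hypothesis dG : forall w, mcder G w (- (gauge_mx br p w *m G w)).
Hypothesis Gq_eq : forall w, G w = 1%:M + w *: Gq w.
Hypothesis dGq : forall w, mdiff Gq w.
Implicit Types (a l m w z : R[i]).

(** The gauge-transformed X as a function of the difference of logarithms,
    defined on the whole plane. *)
Definition Zext w : 'M[R[i]]_N := (G w)^T *m X (cexp w) 1.

(** What is left of Yfun after subtracting the polar part; clog_quot and Gq
    replace the difference quotients of clog and G. *)
Definition Yregular z : 'M[R[i]]_N :=
  (G (clog z))^T *m poly_part p z 1 + clog_quot z *: ((Gq (clog z))^T *m Omega).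

Definition Yfun z : 'M[R[i]]_N := (z - 1)^-1 *: Omega + Yregular z.

Definition Psi z : 'End(g) := mx_end (F (clog z)).

Let GF w : F w *m G w = 1%:M.
Proof. exact: gauge_inv F0 G0 dF dG w. Qed.
Let Gaut w : aut_mx br (G w).
Proof. exact: (gauge_aut_inv brL F0 G0 dF dG). Qed.
Let Gdiff a b : cexp a != cexp b ->
  (G a)^T *m X (cexp a) (cexp b) *m G b = Zext (a - b).
Proof. exact: (gauge_difference brL casimir cybe G0 dG). Qed.
Let mG w : mdiff G w. Proof. by eexists; exact: dG. Qed.

(** G - 1 vanishes at the origin and clog at 1, so the gauge transformation
    does not change the residue of X at z = 1. *)
Lemma Yfun_gauge z : normc (z - 1) < 1 -> z != 1 ->
  Yfun z = (G (clog z))^T *m X z 1.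
Proof.
move=> z1 ne; have z10 : z - 1 != 0 by rewrite subr_eq0.
rewrite /Yfun /Yregular X_split mulmxDr addrCA [RHS]addrC; congr (_ + _).
rewrite Gq_eq (clog_quotE z1) div1r -scalemxAr.
have -> : (1%:M + ((z - 1) * clog_quot z) *: Gq ((z - 1) * clog_quot z))^T =
    1%:M + ((z - 1) * clog_quot z) *: (Gq ((z - 1) * clog_quot z))^T.
  by apply/matrixP => i j; rewrite !mxE eq_sym.
rewrite mulmxDl mul1mx scalerDr -scalemxAl !scalerA mulrA mulVf // mul1r.
by [].
Qed.

Lemma Yfun_cexp l : normc (cexp l - 1) < 1 -> clog (cexp l) = l -> cexp l != 1 ->
  Yfun (cexp l) = Zext l.
Proof. by move=> l1 lK ne; rewrite Yfun_gauge // lK. Qed.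

(** The logarithm inverts the exponential near 0, so Yfun composed with cexp
    is Zext there. *)
Lemma near0_Yfun : exists2 r : R, 0 < r & forall l, normc l < r -> l != 0 ->
  cexp l != 1 /\ Yfun (cexp l) = Zext l.
Proof.
have [r r0 H] := cexpK_near0 R; exists r => // l lr l0.
have [l1 lK] := H l lr.
have ne : cexp l != 1.
  by apply: contra_neq l0 => e; rewrite -lK e clog1.
by split => //; exact: Yfun_cexp.
Qed.

(** (w - a) Zext w at a point a with e^a = 1, with the singularity removed. *)
Definition Znum a w : 'M[R[i]]_N := (G w)^T *m
  ((cexp_quot (w - a))^-1 *: Omega + (w - a) *: poly_part p (cexp w) 1).

Lemma Zext_polar a w : cexp a = 1 -> w != a -> Zext w = (w - a)^-1 *: Znum a w.
Proof.
move=> a1 wa; have wa0 : w - a != 0 by rewrite subr_eq0.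
rewrite /Zext /Znum X_split [RHS]scalemxAr scalerDr !scalerA mulVf // scale1r.
have -> : cexp w - 1 = (w - a) * cexp_quot (w - a).
  by rewrite -[w in LHS](subrK a) cexpD a1 mulr1 cexp_quotE [1 + _]addrC addrK.
by rewrite div1r invfM.
Qed.

Lemma Znum_pole a : Znum a a = (G a)^T *m Omega.
Proof. by rewrite /Znum subrr scale0r addr0 cexp_quot0 invr1 scale1r. Qed.

Let mdiffZ f (K : R[i] -> 'M[R[i]]_N) z : cdiff f z -> mdiff K z ->
  mdiff (fun x => f x *: K x) z.
Proof. by move=> [d df] [D dK]; eexists; exact: mcderZ df dK. Qed.

Let mdiff_poly z : mdiff (fun x => poly_part p (cexp x) 1) z.
Proof. by eexists; exact: poly_part_mcder (cexp_cder z) (cder_cst 1 z). Qed.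

Let cder_sub a z : cder (fun x => x - a) z 1.
Proof. by apply: cder_eq (cderB (cder_id z) (cder_cst a z)) (subr0 _). Qed.

Lemma Znum_mdiff a w : cexp_quot (w - a) != 0 -> mdiff (Znum a) w.
Proof.
move=> nz; apply: mdiffM; first exact: mdiff_tr.
apply: mdiffD; apply: mdiffZ => //; last by exists 1; exact: cder_sub.
- have [d dq] := cexp_quot_cder (w - a).
  have dc := cder_comp (f := @cexp_quot R) (cder_sub a w) dq.
  by eexists; exact: (cderV (f := fun x => cexp_quot (x - a)) nz dc).
- exact: mdiff_cst.
Qed.

Lemma cexp_quot_near a : exists2 r : R, 0 < r & forall w, normc (w - a) < r ->
  cexp_quot (w - a) != 0.
Proof.
have c0 : cdiff (@cexp_quot R) 0 by exact: cexp_quot_cder.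
have [|r r0 H] := cdiff_neq_near (c := 0) c0; first by rewrite cexp_quot0 oner_eq0.
by exists r => // w wr; apply: H; rewrite subr0.
Qed.

Lemma Znum_holomorphic a : holomorphic_at (Znum a) a.
Proof.
have [r r0 H] := cexp_quot_near a.
by apply: (mdiff_holomorphic r0) => z /H; exact: Znum_mdiff.
Qed.

Lemma Zext_holomorphic a : cexp a != 1 -> holomorphic_at Zext a.
Proof.
move=> a1; have [|r r0 H] := cdiff_neq_near (f := @cexp R) (a := a) _ a1.
  by eexists; exact: cexp_cder.
apply: (mdiff_holomorphic r0) => z zr; apply: mdiffM; first exact: mdiff_tr.
by eexists; exact: X_mcder (cexp_cder z) (cder_cst 1 z) (H z zr).
Qed.

Lemma Zext_meromorphic a : meromorphic_at Zext a.
Proof.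
have [a1|a1] := eqVneq (cexp a) 1.
  exists 1%N, (Znum a); split; first exact: Znum_holomorphic.
  apply/near_normc_punctured; exists 1; rewrite ?ltr01 // => z _ za.
  by rewrite expr1 (Zext_polar a1).
exists 0%N, Zext; split; first exact: Zext_holomorphic.
apply/near_normc_punctured; exists 1; rewrite ?ltr01 // => z _ _.
by rewrite expr0 invr1 scale1r.
Qed.

Lemma Znum_pole_unit a : Znum a a \in unitmx.
Proof.
rewrite Znum_pole unitmx_mul unitmx_tr (casimir_unit brL casimir) andbT.
by case/mulmx1_unit: (GF a).
Qed.

Lemma dim_gt0 : (exists x y, br x y != 0) -> (0 < N)%N.
Proof.
move=> [x [y nz]]; rewrite lt0n; apply: contraNneq nz => N0.
have x0 (z : g) : z = 0.
  by rewrite (vb_decomp z) big1 // => -[i iN]; exfalso; move: iN; rewrite N0.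
by rewrite (x0 (br x y)).
Qed.

(** At a zero of e^w - 1 the numerator is invertible, hence nonzero. Elsewhere
    Zext is continuous, so (z - a)^(k+1) Zext z tends to 0 and cannot have the
    nonzero limit required at a pole. *)
Lemma Zext_pole a : (0 < N)%N -> pole Zext a <-> cexp a = 1.
Proof.
move=> N0; split; last first.
  move=> a1; exists 0%N, (Znum a); split; first exact: Znum_holomorphic.
    apply: contraTneq (Znum_pole_unit a) => ->.
    by apply/negP => /mxrank_unit; rewrite mxrank0 => e; move: N0; rewrite -e.
  apply/near_normc_punctured; exists 1; rewrite ?ltr01 // => z _ za.
  by rewrite expr1 (Zext_polar a1).
move=> [k [K [hK K0 /near_normc_punctured[d d0 H]]]].
apply/eqP/negPn/negP => a1.
move/negP: K0; apply; apply/eqP/matrixP => i j; rewrite [RHS]mxE.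
apply: eq0_normc; apply/eqP; rewrite eq_le normc_ge0 andbT.
apply/ler_addgt0Pr => e e0; rewrite add0r.
have e2 : 0 < e / 2 by rewrite divr_gt0.
have [r r0 Hr] := holomorphic_entry_continuous i j hK e2.
have [s s0 Hs] := holomorphic_entry_continuous i j (Zext_holomorphic a1) ltr01.
pose B := normc (Zext a i j) + 1.
have B0 : 0 < B by rewrite ltr_wpDl ?normc_ge0.
(* A point at distance t from a witnesses that |K a i j| < e. *)
pose t := Num.min (Num.min (Num.min r d) (Num.min s 1)) (e / 2 / B) / 2.
have t0 : 0 < t by rewrite divr_gt0 // !lt_min r0 d0 s0 ltr01 divr_gt0.
have tlt (x : R) : Num.min (Num.min (Num.min r d) (Num.min s 1)) (e / 2 / B) <= x -> t < x.
  by move=> le; apply: lt_le_trans le; rewrite ltr_pdivrMr // ltr_pMr ?ltr1n // !lt_min r0 d0 s0 ltr01 divr_gt0.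
have tr : t < r by apply: tlt; rewrite !ge_min lexx.
have td : t < d by apply: tlt; rewrite !ge_min lexx orbT.
have ts : t < s by apply: tlt; rewrite !ge_min lexx !orbT.
have t1 : t < 1 by apply: tlt; rewrite !ge_min lexx !orbT.
have te : t < e / 2 / B by apply: tlt; rewrite !ge_min lexx !orbT.
pose z := a + t%:C.
have za : normc (z - a) = t by rewrite /z addrC addKr normc_real ger0_norm // ltW.
have ne : z != a by rewrite -subr_eq0 -normc_gt0 za.
have zne : z - a != 0 by rewrite subr_eq0.
have KZ : K z i j = (z - a) ^+ k.+1 * Zext z i j.
  by rewrite H ?za // mxE mulrA divff ?mul1r // expf_neq0.
have Zb : normc (Zext z i j) <= B.
  rewrite -[Zext z i j](subrK (Zext a i j)); apply: le_trans (normcD _ _) _.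
  by rewrite addrC lerD2l ltW // Hs // za.
have Kb : normc (K z i j) <= e / 2.
  rewrite KZ normcM normcX za exprS -mulrA.
  apply: (@le_trans _ _ (t * B)); last by rewrite -ler_pdivlMr // ltW.
  rewrite ler_wpM2l ?(ltW t0) //; apply: le_trans Zb.
  by rewrite ler_piMl ?normc_ge0 // exprn_ile1 ?(ltW t0) ?(ltW t1).
rewrite -[K a i j](subrK (K z i j)) (splitr e); apply: le_trans (normcD _ _) _.
by rewrite lerD // normcB ltW // Hr // za.
Qed.

Lemma Zext_poles_discrete : (0 < N)%N -> discrete_subgroup [set a | pole Zext a].
Proof.
move=> N0; split=> [|a b /(Zext_pole a N0) a1 /(Zext_pole b N0) b1|a /(Zext_pole a N0) a1].
- by apply/(Zext_pole 0 N0); exact: cexp0.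
- by apply/(Zext_pole (a - b) N0); rewrite cexpB a1 b1 divr1.
have [r r0 H] := cexp_quot_near a.
apply/near_normc_punctured; exists r => // z zr za /(Zext_pole z N0) z1.
have : (z - a) * cexp_quot (z - a) = 0.
  apply: (addrI 1); rewrite -cexp_quotE addr0 cexpB z1 a1 divr1 //.
by move/eqP; rewrite mulf_eq0 subr_eq0 (negbTE za) (negbTE (H z zr)).
Qed.

Lemma Zext_poles_rank_one : (0 < N)%N -> rank_one [set a | pole Zext a].
Proof.
move=> N0; split.
  exists (twopi_i R); first by apply/(Zext_pole _ N0); exact: cexp_twopi_i.
  by rewrite eq_complex /= eqxx /= mulrn_eq0 /= gt_eqF ?pi_gt0.
move=> a b /(Zext_pole a N0)/cexp_eq1P[m ->] /(Zext_pole b N0)/cexp_eq1P[n ->].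
have [->|m0] := eqVneq m 0.
  by exists 1, 0; rewrite oner_eq0 mulr0z mul0rz add0r.
exists n, (- m); rewrite oppr_eq0 m0 orbT; split => //.
by rewrite -!mulrzA mulrN mulrNz mulrC subrr.
Qed.

(** Near 0 the numerator is close to the residue Omega, which is invertible. *)
Lemma near0_nondegenerate : Defs.nondegenerate (fun l => Yfun (cexp l)).
Proof.
have [r r0 H] := near0_Yfun.
have [s s0 Hs] := cexp_quot_near 0.
have dZ : mdiff (Znum 0) 0 by apply: Znum_mdiff; apply: Hs; rewrite subrr normc0.
have [|t t0 Ht] := cdiff_neq_near (c := 0) (cdiff_det dZ).
  by have := Znum_pole_unit 0; rewrite unitmxE unitfE.
apply/near_normc_punctured; exists (Num.min r t); first by rewrite lt_min r0.
move=> l; rewrite subr0 lt_min => /andP[lr lt] l0.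
have [_ ->] := H l lr l0; rewrite (Zext_polar (cexp0 R)) // subr0.
rewrite mxrank_scale_nz ?invr_eq0 // mxrank_unit // unitmxE unitfE.
by apply: Ht; rewrite subr0.
Qed.

(** The two-parameter equation at (e^(l + m), e^m, 1), in the gauge G. *)
Lemma near0_cybe : cybe_one_param br (fun l => Yfun (cexp l)).
Proof.
have [r r0 H] := near0_Yfun; split.
  exists 1%N, (Znum 0); split; first exact: Znum_holomorphic.
  apply/near_normc_punctured; exists r => // l; rewrite subr0 => lr l0.
  by have [_ ->] := H l lr l0; rewrite (Zext_polar (cexp0 R)) // subr0 expr1.
have r2 : 0 < r / 2 by rewrite divr_gt0.
apply: (near2_normc r2) => l m; rewrite !subr0 => lr mr l0 m0 lm0.
have half_lt : r / 2 < r by rewrite ltr_pdivrMr // ltr_pMr // ltr1n.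
have [l1 ->] := H l (lt_trans lr half_lt) l0.
have [m1 ->] := H m (lt_trans mr half_lt) m0.
have lmr : normc (l + m) < r.
  by apply: le_lt_trans (normcD _ _) _; rewrite (splitr r) ltrD.
have [lm1 ->] := H (l + m) lmr lm0.
have lmm : cexp (l + m) != cexp m.
  by rewrite cexpD -[X in _ != X]mul1r; apply: contra l1 => /eqP/(mulIf (cexp_neq0 m)) ->.
have := Gdiff lmm; rewrite addrK => e1.
have e2 w : Zext w = (G w)^T *m X (cexp w) 1 *m G 0 by rewrite G0 mulmx1.
rewrite -e1 (e2 (l + m)) (e2 m).
by apply: (cybe_aut (Gaut _) (Gaut _) (Gaut _)); exact: cybe.1.
Qed.

Lemma Psi_mx z : end_mx (Psi z) = F (clog z).
Proof. exact: mx_endK. Qed.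

Lemma Psi_holomorphic : holomorphic_at (fun z => end_mx (Psi z)) 1.
Proof.
apply: (mdiff_holomorphic ltr01) => z z1.
have d := mcder_comp (clog_cder z1) (dF (clog z)).
eexists => i j; apply: cder_ext (d i j) => x; by rewrite Psi_mx.
Qed.

Lemma Psi_automorphism z : lie_automorphism br (Psi z).
Proof.
apply: (aut_mx_lie_automorphism brL); rewrite Psi_mx.
  by case/mulmx1_unit: (GF (clog z)).
exact: (gauge_aut brL F0 G0 dF dG).
Qed.

Lemma Yregular_holomorphic : holomorphic_at Yregular 1.
Proof.
apply: (mdiff_holomorphic ltr01) => z z1.
have dcomp (K : R[i] -> 'M[R[i]]_N) : mdiff K (clog z) -> mdiff (fun x => K (clog x)) z.
  by move=> [D dK]; eexists; exact: mcder_comp (clog_cder z1) dK.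
apply: mdiffD; last first.
  apply: mdiffZ; first exact: clog_quot_cder.
  by apply: mdiffM; [apply: mdiff_tr; exact: dcomp|exact: mdiff_cst].
apply: mdiffM; first by apply: mdiff_tr; exact: dcomp.
by eexists; exact: poly_part_mcder (cder_id z) (cder_cst 1 z).
Qed.

(** Here z1 = e^a and z2 = e^b with a and b small, so gauge_difference applies
    and a - b = log (z1 / z2). *)
Lemma near1_descent : \forall z1 \near (1 : R[i]^o) & z2 \near (1 : R[i]^o),
  z1 != z2 -> tensor_map (Psi z1)^-1%VF (Psi z2)^-1%VF (X z1 z2) = Yfun (z1 / z2).
Proof.
have [r r0 H] := near0_Yfun.
have r2 : 0 < r / 2 by rewrite divr_gt0.
have [s s0 Hs] := clog_near1 r2.
have d0 : 0 < Num.min 1 s by rewrite lt_min ltr01.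
apply: (near2_normc d0) => z1 z2; rewrite !lt_min => /andP[z11 z1s] /andP[z21 z2s] ne.
have PsiG z : end_mx (Psi z) *m G (clog z) = 1%:M by rewrite Psi_mx GF.
move: (PsiG z1) (PsiG z2) (clogK z11) (clogK z21) (Hs _ z1s) (Hs _ z2s).
move: (clog z1) (clog z2) => a b Ga Gb Ea Eb ar br2.
rewrite (tensor_map_inv _ Ga Gb).
have ab : cexp a != cexp b by rewrite Ea Eb.
have := Gdiff ab; rewrite Ea Eb => ->.
have l0 : a - b != 0 by rewrite subr_eq0; apply: contra ab => /eqP ->.
have lr : normc (a - b) < r.
  apply: le_lt_trans (normcD _ _) _; rewrite normcN (splitr r).
  exact: ltrD.
by have [_ <-] := H _ lr l0; rewrite cexpB Ea Eb.
Qed.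

Lemma Yfun_trigonometric : (0 < N)%N -> trigonometric br (fun l => Yfun (cexp l)).
Proof.
move=> N0; split; [exact: near0_cybe|exact: near0_nondegenerate|exists Zext].
split; [exact: Zext_meromorphic| |exact: Zext_poles_discrete|exact: Zext_poles_rank_one].
have [r r0 H] := near0_Yfun; apply/near_normc_punctured; exists r => // l.
by rewrite subr0 => lr l0; have [_ ->] := H l lr l0.
Qed.

End Descent.

Theorem theorem11p3 (R : realType) (g : vectType R[i]) (br : g -> g -> g)
    (Omega : 'M[R[i]]_(\dim {:g})) (p : 'M[{poly {poly R[i]}}]_(\dim {:g})) :
  simple_lie br ->
  quadratic_casimir br Omega ->
  cybe_two_param br (quasi_trig_fun Omega p) ->
  exists (Psi : R[i] -> 'End(g)) (s Y : R[i] -> 'M[R[i]]_(\dim {:g})),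
    [/\ holomorphic_at (fun z => end_mx (Psi z)) 1,
        \forall z \near (1 : R[i]^o), lie_automorphism br (Psi z),
        holomorphic_at s 1,
        (forall z, z != 1 -> Y z = (z - 1)^-1 *: Omega + s z) &
        \forall z1 \near (1 : R[i]^o) & z2 \near (1 : R[i]^o), z1 != z2 ->
          tensor_map (Psi z1)^-1%VF (Psi z2)^-1%VF
            (quasi_trig_fun Omega p z1 z2) = Y (z1 / z2)] /\
    trigonometric br (fun l => Y (cexp l)).
Proof.
move=> [brL br0 _] casimir cybe.
have [F [G [Gq [F0 G0 dF dG [Gq_eq dGq]]]]] := gauge_exists p brL.
exists (Psi F), (Yregular Omega p G Gq), (Yfun Omega p G Gq); split; last first.
  exact: (Yfun_trigonometric brL casimir cybe F0 G0 dF dG Gq_eq (dim_gt0 br0)).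
split.
- exact: (Psi_holomorphic dF).
- apply/near_normcP; exists 1; first exact: ltr01.
  by move=> z _; exact: (Psi_automorphism brL F0 G0 dF dG).
- exact: (Yregular_holomorphic _ dG dGq).
- by [].
- exact: (near1_descent brL casimir cybe F0 G0 dF dG Gq_eq).
Qed.
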